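(* $\mathsf{WKL}_0$ does not prove the following statement: the product of any two compact countable second-countable spaces is compact.
   Context: All definitions are made in second-order arithmetic, over $\mathsf{RCA}_0$. Finite sets are coded by natural numbers. An enumerable set is a nondecreasing sequence $A=\langle a_n\rangle_{n=0}^\infty$ of finite sets, representing $\bigcup_n a_n$ (which need not exist as a set); $x\in A$ abbreviates $(\exists n)(x\in a_n)$. A countable second-countable space is a triple $(X,\mathcal U,k)$ where $X\subseteq\mathbb N$ is a set, $\mathcal U=\langle U_i\rangle_{i\in I}$ is an indexed sequence of subsets of $X$ and $k:X\times I\times I\to I$ is a function such that every $x\in X$ is in some $U_i$, and whenever $x\in U_i\cap U_j$ then $x\in U_{k(x,i,j)}\subseteq U_i\cap U_j$. It is compact if for every enumerable set $A\subseteq I$ with $X=\bigcup_{i\in A}U_i$ there is a finite set $a\subseteq A$ with $X=\bigcup_{i\in a}U_i$. The product of $(X,\langle U_i\rangle_{i\in I},k)$ and $(Y,\langle V_j\rangle_{j\in J},\ell)$ is $(X\times Y,\mathcal W,m)$ with $\mathcal W=\langle U_i\times V_j\rangle_{\langle i,j\rangle\in I\times J}$ and $m(\langle x,y\rangle,\langle i,j\rangle,\langle i',j'\rangle)=\langle k(x,i,i'),\ell(y,j,j')\rangle$. *)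

(* Defs.v *)
From Stdlib Require Import List.
Import ListNotations.

(** Two-sorted de Bruijn syntax.  Number variables and set variables are
    indexed separately: a number quantifier does not shift set variables,
    nor conversely. *)

Inductive term : Type :=
| tvar (n : nat)
| tzero
| tone
| tadd (s t : term)
| tmul (s t : term).

Inductive form : Type :=
| fbot
| feq (s t : term)
| flt (s t : term)
| fmem (t : term) (X : nat)
| fimp (p q : form)
| fand (p q : form)
| for_ (p q : form)
| fallN (p : form)
| fexN (p : form)
| fallS (p : form)
| fexS (p : form).

Definition fnot (p : form) : form := fimp p fbot.
Definition fiff (p q : form) : form := fand (fimp p q) (fimp q p).

Fixpoint tsubst (sg : nat -> term) (t : term) : term :=
  match t with
  | tvar n => sg n
  | tzero => tzero
  | tone => tone
  | tadd s t => tadd (tsubst sg s) (tsubst sg t)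
  | tmul s t => tmul (tsubst sg s) (tsubst sg t)
  end.

Definition tshift (n : nat) : term := tvar (S n).

Definition scons {A : Type} (a : A) (f : nat -> A) (n : nat) : A :=
  match n with O => a | S m => f m end.

Definition upN (sg : nat -> term) : nat -> term :=
  scons (tvar 0) (fun n => tsubst tshift (sg n)).

Definition upS (rho : nat -> nat) : nat -> nat :=
  scons 0 (fun n => S (rho n)).

(** Simultaneous substitution of terms for number variables and renaming of
    set variables (the only terms of the set sort). *)
Fixpoint fsubst (sg : nat -> term) (rho : nat -> nat) (p : form) : form :=
  match p with
  | fbot => fbot
  | feq s t => feq (tsubst sg s) (tsubst sg t)
  | flt s t => flt (tsubst sg s) (tsubst sg t)
  | fmem t X => fmem (tsubst sg t) (rho X)
  | fimp p q => fimp (fsubst sg rho p) (fsubst sg rho q)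
  | fand p q => fand (fsubst sg rho p) (fsubst sg rho q)
  | for_ p q => for_ (fsubst sg rho p) (fsubst sg rho q)
  | fallN p => fallN (fsubst (upN sg) rho p)
  | fexN p => fexN (fsubst (upN sg) rho p)
  | fallS p => fallS (fsubst sg (upS rho) p)
  | fexS p => fexS (fsubst sg (upS rho) p)
  end.

Definition liftN (p : form) : form := fsubst tshift (fun X => X) p.
Definition liftS (p : form) : form := fsubst tvar S p.
Definition instN (p : form) (t : term) : form :=
  fsubst (scons t tvar) (fun X => X) p.
Definition instS (p : form) (X : nat) : form :=
  fsubst tvar (scons X (fun Y => Y)) p.

(** Natural deduction for classical two-sorted first-order logic with
    equality on numbers, over a set [T] of nonlogical axioms.  The eigenvariable
    conditions shift the context but not [T], so the free variables of an
    element of [T] are implicitly universally quantified: [T] stands for the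
    set of universal closures of its elements. *)

Inductive prv (T : form -> Prop) : list form -> form -> Prop :=
| prv_ax G p : T p -> prv T G p
| prv_hyp G p : In p G -> prv T G p
| prv_raa G p : prv T (fnot p :: G) fbot -> prv T G p
| prv_impI G p q : prv T (p :: G) q -> prv T G (fimp p q)
| prv_impE G p q : prv T G (fimp p q) -> prv T G p -> prv T G q
| prv_andI G p q : prv T G p -> prv T G q -> prv T G (fand p q)
| prv_andE1 G p q : prv T G (fand p q) -> prv T G p
| prv_andE2 G p q : prv T G (fand p q) -> prv T G q
| prv_orI1 G p q : prv T G p -> prv T G (for_ p q)
| prv_orI2 G p q : prv T G q -> prv T G (for_ p q)
| prv_orE G p q r :
    prv T G (for_ p q) -> prv T (p :: G) r -> prv T (q :: G) r -> prv T G r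
| prv_allNI G p : prv T (map liftN G) p -> prv T G (fallN p)
| prv_allNE G p t : prv T G (fallN p) -> prv T G (instN p t)
| prv_exNI G p t : prv T G (instN p t) -> prv T G (fexN p)
| prv_exNE G p q :
    prv T G (fexN p) -> prv T (p :: map liftN G) (liftN q) -> prv T G q
| prv_allSI G p : prv T (map liftS G) p -> prv T G (fallS p)
| prv_allSE G p X : prv T G (fallS p) -> prv T G (instS p X)
| prv_exSI G p X : prv T G (instS p X) -> prv T G (fexS p)
| prv_exSE G p q :
    prv T G (fexS p) -> prv T (p :: map liftS G) (liftS q) -> prv T G q
| prv_eqI G t : prv T G (feq t t)
| prv_eqE G p s t :
    prv T G (feq s t) -> prv T G (instN p s) -> prv T G (instN p t).

Definition proves (T : form -> Prop) (p : form) : Prop := prv T [] p.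

(** Bounded-quantifier formulas; set parameters are allowed.  The bound must
    not contain the quantified variable, whence the shift. *)
Inductive Delta00 : form -> Prop :=
| D_bot : Delta00 fbot
| D_eq s t : Delta00 (feq s t)
| D_lt s t : Delta00 (flt s t)
| D_mem t X : Delta00 (fmem t X)
| D_imp p q : Delta00 p -> Delta00 q -> Delta00 (fimp p q)
| D_and p q : Delta00 p -> Delta00 q -> Delta00 (fand p q)
| D_or p q : Delta00 p -> Delta00 q -> Delta00 (for_ p q)
| D_ball t p : Delta00 p ->
    Delta00 (fallN (fimp (flt (tvar 0) (tsubst tshift t)) p))
| D_bex t p : Delta00 p ->
    Delta00 (fexN (fand (flt (tvar 0) (tsubst tshift t)) p)).

Inductive Sigma01 : form -> Prop :=
| Sigma01_ex p : Delta00 p -> Sigma01 (fexN p).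

Inductive Pi01 : form -> Prop :=
| Pi01_all p : Delta00 p -> Pi01 (fallN p).

Definition induction_axiom (p : form) : form :=
  fimp
    (fand (instN p tzero)
          (fallN (fimp p (fsubst (scons (tadd (tvar 0) tone) tshift)
                                 (fun X => X) p))))
    (fallN p).

(** In [p] and [q], number variable 0 is the element variable; [liftS] keeps
    the new set from occurring in [p]. *)
Definition comprehension_axiom (p q : form) : form :=
  fimp (fallN (fiff p q))
       (fexS (fallN (fiff (fmem (tvar 0) 0) (liftS p)))).

(** A [bterm], [bset] or [bform] is an expression still waiting for the number
    of number (resp. set) quantifiers above it.  A variable bound at level [d]
    becomes, under [e] quantifiers of its sort, the de Bruijn index
    [e - (d + 1)]; no explicit shifting is needed. *)

Definition bterm := nat -> term.
Definition bset := nat -> nat.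
Definition bform := nat -> nat -> form.

Definition sentence (p : bform) : form := p 0 0.

Definition bzero : bterm := fun _ => tzero.
Definition bone : bterm := fun _ => tone.
Definition badd (s t : bterm) : bterm := fun d => tadd (s d) (t d).
Definition bmul (s t : bterm) : bterm := fun d => tmul (s d) (t d).

Definition beq (s t : bterm) : bform := fun d _ => feq (s d) (t d).
Definition blt (s t : bterm) : bform := fun d _ => flt (s d) (t d).
Definition bmem (t : bterm) (X : bset) : bform := fun d e => fmem (t d) (X e).
Definition bnot (p : bform) : bform := fun d e => fnot (p d e).
Definition bimp (p q : bform) : bform := fun d e => fimp (p d e) (q d e).
Definition band (p q : bform) : bform := fun d e => fand (p d e) (q d e).
Definition bor (p q : bform) : bform := fun d e => for_ (p d e) (q d e).
Definition biff (p q : bform) : bform := fun d e => fiff (p d e) (q d e).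

Definition ballN (p : bterm -> bform) : bform :=
  fun d e => fallN (p (fun d' => tvar (d' - S d)) (S d) e).
Definition bexN (p : bterm -> bform) : bform :=
  fun d e => fexN (p (fun d' => tvar (d' - S d)) (S d) e).
Definition ballS (p : bset -> bform) : bform :=
  fun d e => fallS (p (fun e' => e' - S e) d (S e)).
Definition bexS (p : bset -> bform) : bform :=
  fun d e => fexS (p (fun e' => e' - S e) d (S e)).

Declare Scope so_scope.
Delimit Scope so_scope with so.

Notation "0" := bzero : so_scope.
Notation "1" := bone : so_scope.
Notation "s + t" := (badd s t) : so_scope.
Notation "s * t" := (bmul s t) : so_scope.
Notation "s = t" := (beq s t) : so_scope.
Notation "s < t" := (blt s t) : so_scope.
Notation "t \in X" := (bmem t X) (at level 70, no associativity) : so_scope.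
Notation "~ p" := (bnot p) : so_scope.
Notation "p --> q" := (bimp p q) (at level 90, right associativity) : so_scope.
Notation "p /\ q" := (band p q) : so_scope.
Notation "p \/ q" := (bor p q) : so_scope.
Notation "p <-> q" := (biff p q) : so_scope.
Notation "'allN' x .. y , p" :=
  (ballN (fun x => .. (ballN (fun y => p)) ..))
  (at level 200, x binder, y binder, right associativity) : so_scope.
Notation "'exN' x .. y , p" :=
  (bexN (fun x => .. (bexN (fun y => p)) ..))
  (at level 200, x binder, y binder, right associativity) : so_scope.
Notation "'allS' x .. y , p" :=
  (ballS (fun x => .. (ballS (fun y => p)) ..))
  (at level 200, x binder, y binder, right associativity) : so_scope.
Notation "'exS' x .. y , p" :=
  (bexS (fun x => .. (bexS (fun y => p)) ..))
  (at level 200, x binder, y binder, right associativity) : so_scope.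

Local Open Scope so_scope.

(** Simpson's pairing (i,j) = (i+j)^2 + i, which is injective. *)
Definition pair (i j : bterm) : bterm := (i + j) * (i + j) + i.

Notation "<< x , y , .. , z >>" := (pair .. (pair x y) .. z)
  (at level 0, x at level 65, y at level 65, z at level 65) : so_scope.

(** Simpson's coding of finite sets: the triple (k,(m,n)) represents the set
    of the i < k such that m(i+1)+1 divides n.  Numbers that are not such
    triples represent the empty set; a code is the least representative, so
    every finite set has exactly one code. *)
Definition finmem (i a : bterm) : bform :=
  exN k m n q,
    a = <<k, <<m, n>>>> /\ i < k /\ n = q * (m * (i + 1) + 1).

Notation "i \fin a" := (finmem i a) (at level 70, no associativity) : so_scope.

Definition FinSet (a : bterm) : bform :=
  allN b, b < a --> ~ (allN i, i \fin b <-> i \fin a).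

Definition finsub (a b : bterm) : bform := allN i, i \fin a --> i \fin b.

(** A finite sequence of length [l] is a finite set of pairs (index, value), so
    it also has exactly one code and the initial-segment relation is [finsub]. *)
Definition FinSeq (a l : bterm) : bform :=
  FinSet a
  /\ (allN p, p \fin a --> exN i j, p = <<i, j>>)
  /\ (allN i j j', <<i, j>> \fin a /\ <<i, j'>> \fin a --> j = j')
  /\ (allN i, i < l <-> exN j, <<i, j>> \fin a).

Definition BinSeq (a l : bterm) : bform :=
  FinSeq a l /\ (allN i j, <<i, j>> \fin a --> j < 1 + 1).

(** Functions are sets of pairs; domain [D] and codomain [C] may be proper
    classes given by formulas. *)
Definition Function (D C : bterm -> bform) (f : bset) : bform :=
  (allN p, p \in f --> exN a b, D a /\ C b /\ p = <<a, b>>)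
  /\ (allN a, D a --> exN b, <<a, b>> \in f)
  /\ (allN a b b', <<a, b>> \in f /\ <<a, b'>> \in f --> b = b').

Definition AnyNumber (x : bterm) : bform := x = x.

Definition BinTree (T : bset) : bform :=
  (allN s, s \in T --> exN l, BinSeq s l)
  /\ (allN s t l, s \in T /\ FinSeq t l /\ finsub t s --> t \in T).

Definition Infinite (X : bset) : bform :=
  allN m, exN n, m < n /\ n \in X.

(** The [s] asserted to exist is the code of g[n] = <g(0), ..., g(n-1)>. *)
Definition Path (T g : bset) : bform :=
  Function AnyNumber AnyNumber g
  /\ (allN n, exN s,
        FinSeq s n /\ (allN p, p \fin s --> p \in g) /\ s \in T).

Definition WeakKonig : bform :=
  allS T, BinTree T /\ Infinite T --> exS g, Path T g.

(** The pairs of [Delta01_comprehension] are linked by the premise of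
    [comprehension_axiom]; all schemes allow number and set parameters. *)
Inductive RCA0 : form -> Prop :=
| succ_neq0 : RCA0 (sentence (allN n, ~ (n + 1 = 0)))
| succ_inj : RCA0 (sentence (allN m n, m + 1 = n + 1 --> m = n))
| add_0 : RCA0 (sentence (allN m, m + 0 = m))
| add_succ : RCA0 (sentence (allN m n, m + (n + 1) = (m + n) + 1))
| mul_0 : RCA0 (sentence (allN m, m * 0 = 0))
| mul_succ : RCA0 (sentence (allN m n, m * (n + 1) = (m * n) + m))
| lt_0 : RCA0 (sentence (allN m, ~ (m < 0)))
| lt_succ : RCA0 (sentence (allN m n, m < n + 1 <-> m < n \/ m = n))
| Sigma01_induction p : Sigma01 p -> RCA0 (induction_axiom p)
| Delta01_comprehension p q :
    Sigma01 p -> Pi01 q -> RCA0 (comprehension_axiom p q).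

Inductive WKL0 : form -> Prop :=
| WKL0_RCA0 p : RCA0 p -> WKL0 p
| WKL0_WKL : WKL0 (sentence WeakKonig).

(** A sequence of sets indexed by [I] is a set [U] of pairs; x is in U_i when
    [<<x, i>>] belongs to [U]. *)
Definition IndexedSubsets (X I U : bset) : bform :=
  allN p, p \in U --> exN x i, x \in X /\ i \in I /\ p = <<x, i>>.

Definition CSCSpace (X I U k : bset) : bform :=
  IndexedSubsets X I U
  /\ Function
       (fun p => exN x i j, x \in X /\ i \in I /\ j \in I /\ p = <<x, i, j>>)
       (fun n => n \in I) k
  /\ (allN x, x \in X --> exN i, i \in I /\ <<x, i>> \in U)
  /\ (allN x i j n,
        <<x, i>> \in U /\ <<x, j>> \in U /\ <<<<x, i, j>>, n>> \in k -->
        <<x, n>> \in U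
        /\ (allN z, <<z, n>> \in U --> <<z, i>> \in U /\ <<z, j>> \in U)).

(** [A] is the set of pairs (n, a_n); the set it enumerates need not exist, and
    is only accessed through [enum_mem]. *)
Definition EnumerableSet (A : bset) : bform :=
  Function AnyNumber FinSet A
  /\ (allN m n a b,
        m < n /\ <<m, a>> \in A /\ <<n, b>> \in A --> finsub a b).

Definition enum_mem (x : bterm) (A : bset) : bform :=
  exN n a, <<n, a>> \in A /\ x \fin a.

Definition Compact (X I U : bset) : bform :=
  allS A,
    EnumerableSet A
    /\ (allN i, enum_mem i A --> i \in I)
    /\ (allN x, x \in X <-> exN i, enum_mem i A /\ <<x, i>> \in U) -->
    exN a,
      FinSet a
      /\ (allN i, i \fin a --> enum_mem i A)
      /\ (allN x, x \in X <-> exN i, i \fin a /\ <<x, i>> \in U).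

Definition Product (X I U k Y J V l Z K W m : bset) : bform :=
  (allN p, p \in Z <-> exN x y, x \in X /\ y \in Y /\ p = <<x, y>>)
  /\ (allN p, p \in K <-> exN i j, i \in I /\ j \in J /\ p = <<i, j>>)
  /\ (allN p, p \in W <->
        exN x y i j,
          <<x, i>> \in U /\ <<y, j>> \in V
          /\ p = <<<<x, y>>, <<i, j>>>>)
  /\ (allN p, p \in m <->
        exN x y i j i' j' u v,
          <<<<x, i, i'>>, u>> \in k /\ <<<<y, j, j'>>, v>> \in l
          /\ p = <<<< <<x, y>>, <<i, j>>, <<i', j'>> >>, <<u, v>>>>).

Definition ProductOfCompactIsCompact : bform :=
  allS X I U k Y J V l,
    CSCSpace X I U k /\ Compact X I U
    /\ CSCSpace Y J V l /\ Compact Y J V -->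
    allS Z K W m, Product X I U k Y J V l Z K W m --> Compact Z K W.

(* Main.v *)
From Stdlib Require Import List Arith Lia Bool Classical ClassicalEpsilon Cantor.
Require Import Defs.
Import ListNotations.

(** We build an omega-model of WKL_0.  Let e_0, e_1 : N -> N, and let S_b(x,n) be
    a set of numbers that is cofinite if n < e_b(x) and finite otherwise; its
    elements are decidable, but e_b is only known in the limit.  The points of the
    space X_b are the numbers, with basic neighbourhoods U_b(x,n) = {x} u S_b(x,n).
    An enumerated cover of X_b without a finite subcover contains only finite
    neighbourhoods, so it yields a function dominating e_b: if no function of the
    model dominates e_b, then X_b is compact in the model.

    If moreover e_0(x) <= x + y or e_1(y) <= x + y for all x and y, then each of the
    boxes U_0(x,x+y) x U_1(y,x+y), which cover the product, is bounded in one of its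
    two directions, so finitely many of them do not even cover the diagonal.

    Such e_b and S_b come from a finite-extension construction: a value e_b(x) is
    made large only at an x that bounds all earlier values, which gives the
    inequality above, and only after a given functional has converged at x.  As in
    the hyperimmune-free basis theorem, paths through infinite binary trees can then
    be added one after the other without adding a function that dominates e_0 or
    e_1. *)

(** * Semantics *)

Notation set := (nat -> Prop).

Fixpoint eval (N : nat -> nat) (t : term) : nat :=
  match t with
  | tvar n => N n
  | tzero => 0
  | tone => 1
  | tadd s t => eval N s + eval N t
  | tmul s t => eval N s * eval N t
  end.

(** Number quantifiers range over the standard numbers, so only omega-models occur; such a model is
    given by the class [M] of its sets. *)
Fixpoint sat (M : set -> Prop) (N : nat -> nat) (E : nat -> set) (p : form) : Prop :=
  match p with
  | fbot => False
  | feq s t => eval N s = eval N t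
  | flt s t => eval N s < eval N t
  | fmem t X => E X (eval N t)
  | fimp p q => sat M N E p -> sat M N E q
  | fand p q => sat M N E p /\ sat M N E q
  | for_ p q => sat M N E p \/ sat M N E q
  | fallN p => forall x, sat M (scons x N) E p
  | fexN p => exists x, sat M (scons x N) E p
  | fallS p => forall Y, M Y -> sat M N (scons Y E) p
  | fexS p => exists Y, M Y /\ sat M N (scons Y E) p
  end.

Lemma eval_subst N N' sg t :
  (forall n, N' n = eval N (sg n)) -> eval N (tsubst sg t) = eval N' t.
Proof. intros H; induction t; simpl; congruence. Qed.

Lemma eval_shift N x t : eval (scons x N) (tsubst tshift t) = eval N t.
Proof. now apply eval_subst. Qed.

Lemma sat_subst M p : forall N N' E E' sg rho,
  (forall n, N' n = eval N (sg n)) -> (forall X, E' X = E (rho X)) ->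
  (sat M N E (fsubst sg rho p) <-> sat M N' E' p).
Proof.
  induction p; intros N N' E E' sg rho HN HE; simpl.
  - tauto.
  - now rewrite !(eval_subst N N') by assumption.
  - now rewrite !(eval_subst N N') by assumption.
  - rewrite (eval_subst N N') by assumption. now rewrite HE.
  - rewrite (IHp1 N N' E E'), (IHp2 N N' E E') by assumption. tauto.
  - rewrite (IHp1 N N' E E'), (IHp2 N N' E E') by assumption. tauto.
  - rewrite (IHp1 N N' E E'), (IHp2 N N' E E') by assumption. tauto.
  - assert (K : forall x, sat M (scons x N) E (fsubst (upN sg) rho p)
                          <-> sat M (scons x N') E' p).
    { intros x; apply IHp; [intros [|n]; simpl; [easy|]|exact HE].
      now rewrite eval_shift. }
    firstorder.
  - assert (K : forall x, sat M (scons x N) E (fsubst (upN sg) rho p)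
                          <-> sat M (scons x N') E' p).
    { intros x; apply IHp; [intros [|n]; simpl; [easy|]|exact HE].
      now rewrite eval_shift. }
    firstorder.
  - assert (K : forall Y, sat M N (scons Y E) (fsubst sg (upS rho) p)
                          <-> sat M N' (scons Y E') p).
    { intros x; apply IHp; [easy|intros [|n]; simpl; auto]. }
    firstorder.
  - assert (K : forall Y, sat M N (scons Y E) (fsubst sg (upS rho) p)
                          <-> sat M N' (scons Y E') p).
    { intros x; apply IHp; [easy|intros [|n]; simpl; auto]. }
    firstorder.
Qed.

Lemma sat_liftN M N E x p : sat M (scons x N) E (liftN p) <-> sat M N E p.
Proof. now apply sat_subst. Qed.

Lemma sat_liftS M N E Y p : sat M N (scons Y E) (liftS p) <-> sat M N E p.
Proof. now apply sat_subst. Qed.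

Lemma sat_instN M N E t p :
  sat M N E (instN p t) <-> sat M (scons (eval N t) N) E p.
Proof. apply sat_subst; [now intros [|n]|easy]. Qed.

Lemma sat_instS M N E X p :
  sat M N E (instS p X) <-> sat M N (scons (E X) E) p.
Proof. apply sat_subst; [easy|now intros [|n]]. Qed.

(** By induction on derivations. The axioms are assumed true in every environment with set values in
    [M], since [T] stands for universal closures and the quantifier rules change the environment. *)
Lemma soundness (M : set -> Prop) (T : form -> Prop) :
  (forall p, T p -> forall N E, (forall i, M (E i)) -> sat M N E p) ->
  forall G p, prv T G p -> forall N E, (forall i, M (E i)) ->
  (forall q, In q G -> sat M N E q) -> sat M N E p.
Proof.
  intros HT G p D.
  assert (Hm : forall Y (E : nat -> set), M Y -> (forall i, M (E i)) ->
                 forall i, M (scons Y E i)) by (intros Y E HY HE [|i]; simpl; auto).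
  assert (HN : forall G N E x, (forall q, In q G -> sat M N E q) ->
                 forall q, In q (map liftN G) -> sat M (scons x N) E q).
  { intros G' N E x H q [q' [<- Hq]]%in_map_iff. now apply sat_liftN, H. }
  assert (HS : forall G N E Y, (forall q, In q G -> sat M N E q) ->
                 forall q, In q (map liftS G) -> sat M N (scons Y E) q).
  { intros G' N E Y H q [q' [<- Hq]]%in_map_iff. now apply sat_liftS, H. }
  assert (HC : forall G N E p, sat M N E p -> (forall q, In q G -> sat M N E q) ->
                 forall q, In q (p :: G) -> sat M N E q).
  { intros G' N E p' Hp H q [<-|Hq]; auto. }
  induction D; intros N E HE HG; simpl in *.
  - now apply HT.
  - now apply HG.
  - apply NNPP; intros Hp. apply (IHD N E HE). apply HC; auto.
  - intros Hp. apply IHD; [auto|apply HC; auto].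
  - apply (IHD1 N E HE HG), IHD2; auto.
  - split; auto.
  - now apply (IHD N E HE HG).
  - now apply (IHD N E HE HG).
  - left; auto.
  - right; auto.
  - destruct (IHD1 N E HE HG); [apply IHD2|apply IHD3]; auto; apply HC; auto.
  - intros x. apply IHD; [auto|now apply HN].
  - apply sat_instN, (IHD N E HE HG).
  - exists (eval N t). now apply sat_instN, IHD.
  - destruct (IHD1 N E HE HG) as [x Hx]. apply (sat_liftN M N E x).
    apply IHD2; [auto|apply HC; [easy|now apply HN]].
  - intros Y HY. apply IHD; [auto|now apply HS].
  - apply sat_instS. now apply (IHD N E HE HG).
  - exists (E X). split; [easy|]. now apply sat_instS, IHD.
  - destruct (IHD1 N E HE HG) as [Y [HY Hs]]. apply (sat_liftS M N E Y).
    apply IHD2; [auto|apply HC; [easy|now apply HS]].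
  - reflexivity.
  - apply sat_instN. rewrite <- (IHD1 N E HE HG). apply sat_instN; auto.
Qed.

(** * The notions of the statement read in an omega-model *)

Definition pr (i j : nat) : nat := (i + j) * (i + j) + i.

Definition mem_fin (i a : nat) : Prop :=
  exists k m n q, a = pr k (pr m n) /\ i < k /\ n = q * (m * (i + 1) + 1).

Definition is_finset (a : nat) : Prop :=
  forall b, b < a -> ~ (forall i, mem_fin i b <-> mem_fin i a).

Definition sub_fin (a b : nat) : Prop := forall i, mem_fin i a -> mem_fin i b.

Definition is_finseq (a l : nat) : Prop :=
  is_finset a
  /\ (forall p, mem_fin p a -> exists i j, p = pr i j)
  /\ (forall i j j', mem_fin (pr i j) a /\ mem_fin (pr i j') a -> j = j')
  /\ (forall i, i < l <-> exists j, mem_fin (pr i j) a).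

Definition is_binseq (a l : nat) : Prop :=
  is_finseq a l /\ (forall i j, mem_fin (pr i j) a -> j < 1 + 1).

Definition is_function (D C : set) (f : set) : Prop :=
  (forall p, f p -> exists a b, D a /\ C b /\ p = pr a b)
  /\ (forall a, D a -> exists b, f (pr a b))
  /\ (forall a b b', f (pr a b) /\ f (pr a b') -> b = b').

Definition is_bintree (T : set) : Prop :=
  (forall s, T s -> exists l, is_binseq s l)
  /\ (forall s t l, T s /\ is_finseq t l /\ sub_fin t s -> T t).

Definition is_path (T g : set) : Prop :=
  is_function (fun x => x = x) (fun x => x = x) g
  /\ (forall n, exists s,
        is_finseq s n /\ (forall p, mem_fin p s -> g p) /\ T s).

(** The notions above copy the formulas clause by clause, so that [sat] unfolds to them by
    conversion alone. *)
Lemma sat_weak_konig M N E : sat M N E (sentence WeakKonig) <->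
  forall T, M T -> is_bintree T /\ (forall m, exists n, m < n /\ T n) ->
  exists g, M g /\ is_path T g.
Proof. reflexivity. Qed.

Definition is_space (X I U k : set) : Prop :=
  (forall p, U p -> exists x i, X x /\ I i /\ p = pr x i)
  /\ is_function
       (fun p => exists x i j, X x /\ I i /\ I j /\ p = pr (pr x i) j) I k
  /\ (forall x, X x -> exists i, I i /\ U (pr x i))
  /\ (forall x i j n,
        U (pr x i) /\ U (pr x j) /\ k (pr (pr (pr x i) j) n) ->
        U (pr x n)
        /\ (forall z, U (pr z n) -> U (pr z i) /\ U (pr z j))).

Definition is_enumeration (A : set) : Prop :=
  is_function (fun x => x = x) is_finset A
  /\ (forall m n a b, m < n /\ A (pr m a) /\ A (pr n b) -> sub_fin a b).

Definition mem_enum (x : nat) (A : set) : Prop :=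
  exists n a, A (pr n a) /\ mem_fin x a.

Definition is_compact (M : set -> Prop) (X I U : set) : Prop :=
  forall A, M A ->
    is_enumeration A
    /\ (forall i, mem_enum i A -> I i)
    /\ (forall x, X x <-> exists i, mem_enum i A /\ U (pr x i)) ->
    exists a,
      is_finset a
      /\ (forall i, mem_fin i a -> mem_enum i A)
      /\ (forall x, X x <-> exists i, mem_fin i a /\ U (pr x i)).

Definition is_product (X I U k Y J V l Z K W m : set) : Prop :=
  (forall p, Z p <-> exists x y, X x /\ Y y /\ p = pr x y)
  /\ (forall p, K p <-> exists i j, I i /\ J j /\ p = pr i j)
  /\ (forall p, W p <->
        exists x y i j,
          U (pr x i) /\ V (pr y j) /\ p = pr (pr x y) (pr i j))
  /\ (forall p, m p <->
        exists x y i j i' j' u v,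
          k (pr (pr (pr x i) i') u) /\ l (pr (pr (pr y j) j') v)
          /\ p = pr (pr (pr (pr x y) (pr i j)) (pr i' j')) (pr u v)).

Lemma sat_product M N E : sat M N E (sentence ProductOfCompactIsCompact) <->
  forall X, M X -> forall I, M I -> forall U, M U -> forall k, M k ->
  forall Y, M Y -> forall J, M J -> forall V, M V -> forall l, M l ->
  is_space X I U k /\ is_compact M X I U
  /\ is_space Y J V l /\ is_compact M Y J V ->
  forall Z, M Z -> forall K, M K -> forall W, M W -> forall m, M m ->
  is_product X I U k Y J V l Z K W m -> is_compact M Z K W.
Proof. reflexivity. Qed.

(** * Coding of finite sets and sequences *)

(** With t = i + j the code lies between t^2 and t^2 + t, hence below (t + 1)^2. So it determines t,
    and then both components. *)
Lemma pr_lt_sq i j s : i + j < s -> pr i j < s * s.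
Proof. unfold pr; nia. Qed.

Lemma pr_inj i j i' j' : pr i j = pr i' j' -> i = i' /\ j = j'.
Proof.
  intros H.
  assert (i + j = i' + j').
  { destruct (lt_eq_lt_dec (i + j) (i' + j')) as [[Hl|He]|Hl]; [|easy|].
    - apply pr_lt_sq in Hl. unfold pr in H, Hl. lia.
    - apply pr_lt_sq in Hl. unfold pr in H, Hl. lia. }
  unfold pr in H. assert (i = i') by nia. lia.
Qed.

Ltac pr_inj :=
  repeat match goal with
  | H : pr _ _ = pr _ _ |- _ =>
      let H1 := fresh in let H2 := fresh in
      apply pr_inj in H; destruct H as [H1 H2]; try subst
  end.

Lemma pr_ge_l i j : i <= pr i j.
Proof. unfold pr; lia. Qed.

Lemma pr_ge_r i j : j <= pr i j.
Proof. unfold pr; nia. Qed.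

Lemma pr_mono i j i' j' : i <= i' -> j <= j' -> pr i j <= pr i' j'.
Proof. unfold pr; nia. Qed.

Lemma mem_fin_lt i a : mem_fin i a -> i < a.
Proof.
  intros (k & m & n & q & -> & Hi & _). pose proof (pr_ge_l k (pr m n)). lia.
Qed.

(** The fact behind Goedel's beta function: a common divisor divides j - i, hence [m] by hypothesis,
    hence 1. *)
Lemma gcd_factors m i j : (forall d, d <> 0 -> d <= i + j -> Nat.divide d m) ->
  i < j -> Nat.gcd (m * (i + 1) + 1) (m * (j + 1) + 1) = 1.
Proof.
  intros Hm Hij.
  set (g := Nat.gcd _ _).
  assert (Ha : Nat.divide g (m * (i + 1) + 1)) by apply Nat.gcd_divide_l.
  assert (Hb : Nat.divide g (m * (j + 1) + 1)) by apply Nat.gcd_divide_r.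
  assert (Hd : Nat.divide g (j - i)).
  (* The linear combination in which [m] cancels. *)
  { replace (j - i) with
      ((j + 1) * (m * (i + 1) + 1) - (i + 1) * (m * (j + 1) + 1)) by nia.
    apply Nat.divide_sub_r; now apply Nat.divide_mul_r. }
  assert (Hg : Nat.divide g m).
  { eapply Nat.divide_trans; [exact Hd|]. apply Hm; lia. }
  apply Nat.divide_1_r.
  replace 1 with (m * (i + 1) + 1 - m * (i + 1)) by lia.
  apply Nat.divide_sub_r; [easy|]. now apply Nat.divide_mul_l.
Qed.

Lemma divide_fact d k : d <> 0 -> d <= k -> Nat.divide d (fact k).
Proof.
  intros Hd. induction k as [|k IH]; intros Hk; [lia|].
  change (fact (S k)) with (S k * fact k).
  destruct (Nat.eq_dec d (S k)) as [->|Hn].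
  - apply Nat.divide_factor_l.
  - apply Nat.divide_mul_r, IH. lia.
Qed.

(** The factors m(i+1)+1 with i < k are pairwise coprime, so such a factor divides the product over
    [l] exactly when its index is in [l]. *)
Lemma fin_represented (l : list nat) : exists a, forall i, mem_fin i a <-> In i l.
Proof.
  set (k := S (list_max l)).
  (* All elements are below [k], so every nonzero number up to the sum of two of them divides this
     factorial, as [gcd_factors] demands. *)
  set (m := fact (k + k)).
  set (f := fun i => m * (i + 1) + 1).
  assert (Hk : forall i, In i l -> i < k).
  { intros i Hi. unfold k. pose proof (proj1 (list_max_le l (list_max l)) (le_n _)) as H.
    rewrite Forall_forall in H. specialize (H i Hi). lia. }
  assert (Hm : m <> 0) by apply fact_neq_0.
  assert (Hc : forall i j, i < k -> j < k -> i <> j -> Nat.gcd (f i) (f j) = 1).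
  { intros i j Hi Hj Hij.
    assert (Hd : forall d, d <> 0 -> d <= i + j -> Nat.divide d m)
      by (intros d Hd Hle; apply divide_fact; lia).
    destruct (lt_dec i j).
    - now apply gcd_factors.
    - rewrite Nat.gcd_comm. apply gcd_factors; [|lia].
      intros d ? ?; apply Hd; lia. }
  set (n := fold_right (fun i r => f i * r) 1 l).
  exists (pr k (pr m n)). intros i.
  assert (Hn : forall i l', i < k -> (forall j, In j l' -> j < k) ->
     (Nat.divide (f i) (fold_right (fun i r => f i * r) 1 l') <-> In i l')).
  { clear i. intros i l' Hi. induction l' as [|j l' IH]; intros Hl; cbn [fold_right In].
    - split; [|easy]. intros H. apply Nat.divide_1_r in H. unfold f in H. nia.
    - destruct (Nat.eq_dec i j) as [->|Hij].
      + split; [now left|]. intros _. apply Nat.divide_factor_l.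
      + rewrite <- IH by (intros; apply Hl; now right). split.
        * intros H. right. eapply Nat.gauss; [exact H|].
          apply Hc; auto. apply Hl; now left.
        * intros [->|H]; [easy|]. now apply Nat.divide_mul_r. }
  specialize (Hn i l). fold n in Hn. split.
  - intros (k' & m' & n' & q & H & Hi & Hq). apply pr_inj in H as [-> H].
    apply pr_inj in H as [-> ->]. apply Hn; auto. exists q. exact Hq.
  - intros H. assert (Hi := Hk i H). apply Hn in H as [q Hq]; auto.
    exists k, m, n, q. auto.
Qed.

Lemma least_nat (P : nat -> Prop) n : P n -> exists m, P m /\ forall k, k < m -> ~ P k.
Proof.
  induction n as [n IH] using lt_wf_ind; intros Hn.
  destruct (classic (exists k, k < n /\ P k)) as [(k & Hk & HP)|H].
  - now apply (IH k).
  - exists n. split; [easy|]. intros k Hk HP. apply H; eauto.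
Qed.

Lemma finset_exists (l : list nat) :
  exists a, is_finset a /\ forall i, mem_fin i a <-> In i l.
Proof.
  destruct (fin_represented l) as [a0 H0].
  destruct (least_nat (fun a => forall i, mem_fin i a <-> In i l) _ H0) as (a & Ha & Hmin).
  exists a. split; [|easy]. intros b Hb H. apply (Hmin b Hb).
  intros i. now rewrite H.
Qed.

Lemma finset_ext a b : is_finset a -> is_finset b ->
  (forall i, mem_fin i a <-> mem_fin i b) -> a = b.
Proof.
  intros Ha Hb H. destruct (lt_eq_lt_dec a b) as [[Hl|He]|Hl]; [|easy|].
  - now apply (Hb a Hl) in H.
  - destruct (Ha b Hl). intros i. now rewrite H.
Qed.

Definition fcode (l : list nat) : nat :=
  proj1_sig (constructive_indefinite_description _ (finset_exists l)).

Lemma fcode_finset l : is_finset (fcode l).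
Proof. unfold fcode. destruct constructive_indefinite_description as [a [? ?]]; easy. Qed.

Lemma mem_fcode l i : mem_fin i (fcode l) <-> In i l.
Proof. unfold fcode. destruct constructive_indefinite_description as [a [? H]]; apply H. Qed.

Definition bit (b : bool) : nat := if b then 1 else 0.

Lemma bit_inj b b' : bit b = bit b' -> b = b'.
Proof. now destruct b, b'. Qed.

Definition seqgraph (s : list bool) : list nat :=
  map (fun i => pr i (bit (nth i s false))) (seq 0 (length s)).

Lemma in_seqgraph s p :
  In p (seqgraph s) <-> exists i, i < length s /\ p = pr i (bit (nth i s false)).
Proof.
  unfold seqgraph. rewrite in_map_iff. split.
  - intros (i & <- & Hi). apply in_seq in Hi. exists i. split; [lia|easy].
  - intros (i & Hi & ->). exists i. split; [easy|]. apply in_seq. lia.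
Qed.

Definition seqcode (s : list bool) : nat := fcode (seqgraph s).

Lemma mem_seqcode s i j :
  mem_fin (pr i j) (seqcode s) <-> i < length s /\ j = bit (nth i s false).
Proof.
  unfold seqcode. rewrite mem_fcode, in_seqgraph. split.
  - intros (i' & Hi & H). pr_inj. auto.
  - intros [Hi ->]. eauto.
Qed.

Lemma seqcode_binseq s : is_binseq (seqcode s) (length s).
Proof.
  split; [split; [apply fcode_finset|split; [|split]]|].
  - intros p Hp. apply mem_fcode, in_seqgraph in Hp as (i & _ & ->). eauto.
  - intros i j j' [H1 H2]. apply mem_seqcode in H1 as [_ ->], H2 as [_ ->]. easy.
  - intros i. split.
    + intros Hi. exists (bit (nth i s false)). now apply mem_seqcode.
    + intros [j H]. now apply mem_seqcode in H.
  - intros i j H. apply mem_seqcode in H as [_ ->]. destruct nth; simpl; lia.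
Qed.

(** A code is the least representative, so comparing elements suffices; bit i is read off by asking
    whether the pair of i and 1 is an element. *)
Lemma binseq_seqcode a l : is_binseq a l -> exists s, length s = l /\ a = seqcode s.
Proof.
  intros [(Ha & Hp & Hf & Hd) Hb].
  set (b := fun i => if excluded_middle_informative (mem_fin (pr i 1) a)
                     then true else false).
  exists (map b (seq 0 l)).
  assert (Hl : length (map b (seq 0 l)) = l) by now rewrite length_map, length_seq.
  split; [easy|].
  assert (Hg : forall i j, mem_fin (pr i j) a <-> i < l /\ j = bit (b i)).
  { intros i j. split.
    - intros H. split; [apply Hd; eauto|]. specialize (Hb i j H) as Hj.
      unfold b. destruct excluded_middle_informative as [H1|H1]; simpl.
      + apply (Hf i); auto.
      + destruct j as [|[|]]; [easy|contradiction|lia].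
    - intros [Hi ->]. apply Hd in Hi as [j H]. specialize (Hb i j H) as Hj.
      unfold b. destruct excluded_middle_informative as [H1|H1]; simpl; [easy|].
      destruct j as [|[|]]; [easy|contradiction|lia]. }
  apply finset_ext; [easy|apply fcode_finset|].
  assert (Hs : forall i j, mem_fin (pr i j) (seqcode (map b (seq 0 l))) <->
                           i < l /\ j = bit (b i)).
  { intros i j. rewrite mem_seqcode, Hl. split; intros [Hi ->]; (split; [easy|]).
    - rewrite (nth_indep _ false (b 0)), map_nth, seq_nth by (rewrite ?Hl; lia). easy.
    - rewrite (nth_indep _ false (b 0)), map_nth, seq_nth by (rewrite ?Hl; lia). easy. }
  intros p. split; intros H.
  - destruct (Hp p H) as (i & j & ->). now apply Hs, Hg.
  - destruct (proj1 (in_seqgraph _ _) (proj1 (mem_fcode _ _) H)) as (i & _ & ->).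
    now apply Hg, Hs.
Qed.

Definition pre (P : nat -> bool) (n : nat) : list bool := map P (seq 0 n).

Lemma length_pre P n : length (pre P n) = n.
Proof. unfold pre. now rewrite length_map, length_seq. Qed.

Lemma nth_pre P n i : i < n -> nth i (pre P n) false = P i.
Proof.
  intros Hi. unfold pre.
  rewrite (nth_indep _ false (P 0)), map_nth, seq_nth
    by (rewrite ?length_map, ?length_seq; lia).
  easy.
Qed.

Lemma pre_S P n : pre P (S n) = pre P n ++ [P n].
Proof. unfold pre. now rewrite seq_S, map_app. Qed.

Definition extends (s : list bool) (P : nat -> bool) : Prop := pre P (length s) = s.

Lemma extends_snoc s P : extends s P -> extends (s ++ [P (length s)]) P.
Proof.
  unfold extends. intros H. rewrite length_app. simpl.
  now rewrite Nat.add_1_r, pre_S, H.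
Qed.

Lemma extends_nth s P i : extends s P -> i < length s -> nth i s false = P i.
Proof. intros H Hi. rewrite <- H. now apply nth_pre. Qed.

Lemma extends_pre P P' n : extends (pre P n) P' -> forall i, i < n -> P' i = P i.
Proof.
  intros H i Hi. rewrite <- (nth_pre P n i Hi). symmetry.
  apply extends_nth; [easy|]. now rewrite length_pre.
Qed.

(* Compactness of Cantor space, in the form of bar induction. *)
Lemma fan (Q : list bool -> Prop) :
  (forall s, Q (s ++ [true]) -> Q (s ++ [false]) -> Q s) ->
  (forall P, exists n, Q (pre P n)) -> Q [].
Proof.
  intros Hstep Hbar. apply NNPP; intros H0.
  set (next := fun s => if excluded_middle_informative (Q (s ++ [true]))
                        then false else true).
  set (f := fix f n := match n with
                       | 0 => []
                       | S n => f n ++ [next (f n)]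
                       end).
  destruct (Hbar (fun n => next (f n))) as [n Hn].
  assert (Hf : forall n, pre (fun n => next (f n)) n = f n).
  { clear n Hn. intros n. induction n as [|n IH]; [easy|]. now rewrite pre_S, IH. }
  rewrite Hf in Hn.
  assert (Hnot : forall n, ~ Q (f n)); [|now apply (Hnot n)].
  clear n Hn. intros n. induction n as [|n IH]; [easy|]. simpl.
  unfold next at 1. destruct excluded_middle_informative as [Ht|Ht]; [|easy].
  intros Hf'. apply IH. now apply Hstep.
Qed.

Lemma dependent_choice {A} (Inv : nat -> A -> Prop) (R : nat -> A -> A -> Prop) a0 :
  Inv 0 a0 ->
  (forall n a, Inv n a -> exists a', Inv (S n) a' /\ R n a a') ->
  exists f, f 0 = a0 /\ (forall n, Inv n (f n)) /\ (forall n, R n (f n) (f (S n))).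
Proof.
  intros H0 Hs.
  (* The step is made total, so that the chosen successor depends on [n] and [a] only and not on a
     proof of the invariant. *)
  assert (Hs' : forall n a, exists a', Inv n a -> Inv (S n) a' /\ R n a a').
  { intros n a. destruct (classic (Inv n a)) as [H|H].
    - destruct (Hs n a H) as [a' Ha]. eauto.
    - exists a0. easy. }
  set (next := fun n a => proj1_sig (constructive_indefinite_description _ (Hs' n a))).
  assert (Hn : forall n a, Inv n a -> Inv (S n) (next n a) /\ R n a (next n a)).
  { intros n a. exact (proj2_sig (constructive_indefinite_description _ (Hs' n a))). }
  set (f := fix f n := match n with 0 => a0 | S n => next n (f n) end).
  assert (Hf : forall n, Inv n (f n)).
  { intros n. induction n as [|n IH]; [easy|]. now apply Hn. }
  exists f. split; [easy|]. split; [easy|]. intros n. now apply Hn.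
Qed.

(** * Codes for open predicates of an oracle *)

Definition halves (Z : set) : set := fun v => Z (2 * v).

Definition join (Z : set) (P : nat -> bool) : set :=
  fun v => if Nat.even v then Z (Nat.div2 v) else P (Nat.div2 v) = true.

Lemma join_even Z P v : join Z P (2 * v) = Z v.
Proof. unfold join. now rewrite Nat.even_even, Nat.div2_double. Qed.

Lemma join_odd Z P v : join Z P (2 * v + 1) = (P v = true).
Proof.
  unfold join. rewrite Nat.even_odd, Nat.add_1_r, Nat.div2_succ_double. easy.
Qed.

(** Names for the explicit operations that put particular sets into the model. Names instead of
    functions keep the codes countable. *)
Inductive operation : Type :=
| onat | opairs | omeet | opairs2 | omeet2 | odiag
| onbhd (b : bool) | oboxes | ocaught | obranch.

(** The function [k] of both spaces: a point z in the neighbourhoods with indices (x,n) and (x',n')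
    is assigned the index (z,n+n'). *)
Definition meet_graph (p : nat) : Prop :=
  exists z x n x' n', p = pr (pr (pr z (pr x n)) (pr x' n')) (pr z (n + n')).

Definition pairs (p : nat) : Prop := exists x n, p = pr x n.

Definition boxlist (n : nat) : list nat :=
  map (fun c => pr (pr (fst c) (fst c + snd c)) (pr (snd c) (fst c + snd c)))
      (list_prod (seq 0 n) (seq 0 n)).

(** [ocaught] relates z to the n for which some index (x,n) enumerated by [Y0] names a neighbourhood
    of z in [Y1]. [obranch] turns the odd half of a join into the graph of a function. *)
Definition interp (o : operation) (Y0 Y1 : set) (p : nat) : Prop :=
  match o with
  | onat => True
  | opairs => pairs p
  | omeet => meet_graph p
  | opairs2 => exists i j, pairs i /\ pairs j /\ p = pr i j
  | omeet2 =>
      exists x y i j i' j' u v,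
        meet_graph (pr (pr (pr x i) i') u) /\ meet_graph (pr (pr (pr y j) j') v)
        /\ p = pr (pr (pr (pr x y) (pr i j)) (pr i' j')) (pr u v)
  | odiag => exists n, p = pr n (fcode (boxlist n))
  | onbhd b =>
      exists z x n, p = pr z (pr x n)
                    /\ (z = x \/ Y0 (pr z (pr (pr x n) (bit b))))
  | oboxes =>
      exists x y i j, Y0 (pr x i) /\ Y1 (pr y j) /\ p = pr (pr x y) (pr i j)
  | ocaught =>
      exists z n x m a, p = pr z n /\ Y0 (pr m a) /\ mem_fin (pr x n) a
                        /\ Y1 (pr z (pr x n))
  | obranch =>
      exists n b, p = pr n (bit b) /\ (b = true <-> Y0 (2 * n + 1))
  end.

Definition atom : Type := nat * bool * nat.

Definition consistent (E : nat -> set) (D : list atom) : Prop :=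
  forall i b w, In (i, b, w) D -> (E i w <-> b = true).

(** [lform] serves comprehension, [lpath] detects that a sequence leaves a tree, and [lbound] and
    [lsome] serve the basis theorem: in these two, set 1 signals that the oracle has left a closed
    set, and then everything is enumerated. *)
Inductive label : Type :=
| lform (p q : form) (ns : list nat)
| lop (o : operation)
| lpath
| lbound
| lsome (x : nat).

(** A class fixed in advance lets [enumop] evaluate formulas before a model is built; formulas
    without set quantifiers have the same truth value over every class. *)
Definition everything (Y : set) : Prop := True.

(* [enumop l true D v] ([enumop l false D v]): the finite information [D] on a
   sequence of sets puts [v] into (outside) the set computed by [l]. *)
Definition enumop (l : label) (b : bool) (D : list atom) (v : nat) : Prop :=
  match l with
  | lform p q ns =>
      forall E, consistent E D ->
        if b then sat everything (scons v (fun i => nth i ns 0)) E p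
        else ~ sat everything (scons v (fun i => nth i ns 0)) E q
  | lop o =>
      forall E, consistent E D ->
        if b then interp o (E 0) (E 1) v else ~ interp o (E 0) (E 1) v
  | lpath =>
      exists s, In (0, false, seqcode s) D
                /\ forall i, i < length s -> In (1, nth i s false, 2 * i + 1) D
  | lbound =>
      (exists x n m, v = pr x m /\ n <= m /\ In (0, true, pr x n) D)
      \/ In (1, true, 0) D
  | lsome x => (exists n, In (0, true, pr x n) D) \/ In (1, true, 0) D
  end.

(** A countable family of open predicates closed under what the construction needs. [call]
    quantifies over all binary sequences joined to the oracle and stays open because Cantor space is
    compact. *)
Inductive code : Type :=
| coracle
| cleft (c : code)
| ccons (a c : code)
| cenum (l : label) (c : code)
| call (c : code).

(* A code denotes a sequence of pairs of open predicates of an oracle [Z]; for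
   the [i]-th set it gives a positive and a negative enumeration. *)
Fixpoint den (c : code) (i : nat) (b : bool) (Z : set) (v : nat) : Prop :=
  match c with
  | coracle => if b then Z v else ~ Z v
  | cleft c => den c i b (halves Z) v
  | ccons a c => match i with 0 => den a 0 b Z v | S i => den c i b Z v end
  | cenum l c =>
      exists D, enumop l b D v /\ forall i b w, In (i, b, w) D -> den c i b Z w
  | call c => forall P, den c i b (join Z P) v
  end.

Definition agree (B : nat) (Z Z' : set) : Prop := forall v, v < B -> (Z v <-> Z' v).

Lemma agree_le B B' Z Z' : B <= B' -> agree B' Z Z' -> agree B Z Z'.
Proof. intros HB H v Hv. apply H. lia. Qed.

Lemma agree_join B Z Z' P P' : agree B Z Z' -> (forall i, i < B -> P i = P' i) ->
  agree B (join Z P) (join Z' P').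
Proof.
  intros HZ HP v Hv.
  destruct (Nat.Even_or_Odd v) as [[w ->]|[w ->]].
  - rewrite !join_even. apply HZ. lia.
  - rewrite !join_odd. rewrite HP by lia. easy.
Qed.

(** The use principle: an enumeration consults only finitely much of the oracle. *)
Lemma den_open c : forall i b Z v, den c i b Z v ->
  exists B, forall Z', agree B Z Z' -> den c i b Z' v.
Proof.
  induction c as [|c IH|a IHa c IHc|l c IH|c IH]; intros i b Z v H; simpl in *.
  - exists (S v). intros Z' HZ. specialize (HZ v (Nat.lt_succ_diag_r v)).
    destruct b; tauto.
  - destruct (IH _ _ _ _ H) as [B HB]. exists (2 * B). intros Z' HZ. apply HB.
    intros w Hw. apply HZ. lia.
  - destruct i; [now apply IHa|now apply IHc].
  - destruct H as (D & HD & H).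
    assert (HB : exists B, forall Z', agree B Z Z' ->
                   forall i b w, In (i, b, w) D -> den c i b Z' w).
    { clear HD. induction D as [|[[i' b'] w'] D IHD].
      - exists 0. intros Z' _ ? ? ? [].
      - destruct IHD as [B1 HB1]; [intros; apply H; now right|].
        destruct (IH i' b' Z w') as [B2 HB2]; [apply H; now left|].
        exists (max B1 B2). intros Z' HZ ? ? ? [[= <- <- <-]|Hin].
        + apply HB2. eapply agree_le; [|exact HZ]. lia.
        + apply HB1; [|easy]. eapply agree_le; [|exact HZ]. lia. }
    destruct HB as [B HB]. exists B. intros Z' HZ. exists D. split; [easy|]. now apply HB.
  (* [Q s] says that one bound serves all sequences extending [s]; the use of a single sequence
     gives [Q] at one of its prefixes, and [fan] makes the bound uniform. *)
  - set (Q := fun s => exists B, forall Z' P, agree B Z Z' -> extends s P ->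
                den c i b (join Z' P) v).
    cut (Q []).
    { intros [B HB]. exists B. intros Z' HZ P. now apply HB. }
    apply fan.
    + intros s [B1 H1] [B0 H0]. exists (max B1 B0). intros Z' P HZ Hs.
      apply extends_snoc in Hs. destruct (P (length s)).
      * apply H1; [|easy]. eapply agree_le; [|exact HZ]. lia.
      * apply H0; [|easy]. eapply agree_le; [|exact HZ]. lia.
    + intros P. destruct (IH _ _ _ _ (H P)) as [B HB].
      exists B, B. intros Z' P' HZ HP. apply HB. apply agree_join; [easy|].
      intros j Hj. symmetry. now apply (extends_pre P P' B).
Qed.

Lemma den_ext c i b Z Z' v : (forall w, Z w <-> Z' w) ->
  (den c i b Z v <-> den c i b Z' v).
Proof.
  intros H; split; intros Hd; destruct (den_open _ _ _ _ _ Hd) as [B HB];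
    apply HB; intros w _; firstorder.
Qed.

Lemma den_left c i b Z P v : den (cleft c) i b (join Z P) v <-> den c i b Z v.
Proof.
  simpl. apply den_ext. intros w. unfold halves. now rewrite join_even.
Qed.

(** Enumerating both the set and its complement is the counterpart of being computable from [Z]. *)
Definition represents (c : code) (i : nat) (Z Y : set) : Prop :=
  forall v, (den c i true Z v <-> Y v) /\ (den c i false Z v <-> ~ Y v).

Lemma represents_left c i Z P Y :
  represents c i Z Y -> represents (cleft c) i (join Z P) Y.
Proof. intros H v. now rewrite !den_left. Qed.

Lemma represents_oracle i Z : represents coracle i Z Z.
Proof. intros v. simpl. tauto. Qed.

Definition agreeS (B : nat) (E E' : nat -> set) : Prop :=
  forall i, i < B -> agree B (E i) (E' i).

Lemma diagram_decides (E : nat -> set) B : exists D,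
  (forall i b w, In (i, b, w) D -> (E i w <-> b = true)) /\
  (forall E', consistent E' D -> agreeS B E E').
Proof.
  set (b := fun c => if excluded_middle_informative (E (fst c) (snd c))
                     then true else false).
  assert (Hb : forall i w, b (i, w) = true <-> E i w).
  { intros i w. unfold b; simpl. destruct excluded_middle_informative; easy. }
  exists (map (fun c => (fst c, b c, snd c)) (list_prod (seq 0 B) (seq 0 B))). split.
  - intros i b' w H. apply in_map_iff in H as ([i' w'] & [= <- <- <-] & _). now rewrite Hb.
  - intros E' H i Hi w Hw. rewrite <- Hb. symmetry. apply H.
    apply in_map_iff. exists (i, w). split; [easy|].
    apply in_prod; apply in_seq; lia.
Qed.

Definition open_at (R : (nat -> set) -> Prop) (E : nat -> set) : Prop :=
  R E -> exists B, forall E', agreeS B E E' -> R E'.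

(** An open property of [E] is secured by a finite diagram of [E], which [c] enumerates. Conversely
    [E] is consistent with every diagram that [c] enumerates. *)
Lemma enum_open c Z E (R : (nat -> set) -> Prop) :
  (forall i, represents c i Z (E i)) -> open_at R E ->
  ((exists D, (forall E', consistent E' D -> R E') /\
              forall i b w, In (i, b, w) D -> den c i b Z w) <-> R E).
Proof.
  intros Hc HR.
  assert (HD : forall i b w, den c i b Z w <-> (E i w <-> b = true)).
  { intros i [] w; destruct (Hc i w) as [H1 H2]; [rewrite H1|rewrite H2];
      intuition congruence. }
  split.
  - intros (D & HDR & Hv). apply HDR. intros i b w Hin. now apply HD, Hv.
  - intros H. destruct (HR H) as [B HB]. destruct (diagram_decides E B) as (D & H1 & H2).
    exists D. split.
    + intros E' HE. now apply HB, H2.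
    + intros i b w Hin. now apply HD, H1.
Qed.

(** * An injective numbering of the codes *)

Definition triple (a b c : nat) : nat := Cantor.to_nat (a, Cantor.to_nat (b, c)).
Arguments triple : simpl never.

Lemma to_nat_inj p q : Cantor.to_nat p = Cantor.to_nat q -> p = q.
Proof. intros H. rewrite <- (Cantor.cancel_of_to p), H. apply Cantor.cancel_of_to. Qed.

Lemma triple_inj a b c a' b' c' :
  triple a b c = triple a' b' c' -> a = a' /\ b = b' /\ c = c'.
Proof.
  unfold triple. intros H. apply to_nat_inj in H. apply pair_equal_spec in H as [Ha H].
  apply to_nat_inj in H. apply pair_equal_spec in H as [Hb Hc]. auto.
Qed.

Fixpoint num_term (t : term) : nat :=
  match t with
  | tvar n => triple 0 n 0
  | tzero => triple 1 0 0
  | tone => triple 2 0 0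
  | tadd s t => triple 3 (num_term s) (num_term t)
  | tmul s t => triple 4 (num_term s) (num_term t)
  end.

Fixpoint num_form (p : form) : nat :=
  match p with
  | fbot => triple 0 0 0
  | feq s t => triple 1 (num_term s) (num_term t)
  | flt s t => triple 2 (num_term s) (num_term t)
  | fmem t X => triple 3 (num_term t) X
  | fimp p q => triple 4 (num_form p) (num_form q)
  | fand p q => triple 5 (num_form p) (num_form q)
  | for_ p q => triple 6 (num_form p) (num_form q)
  | fallN p => triple 7 (num_form p) 0
  | fexN p => triple 8 (num_form p) 0
  | fallS p => triple 9 (num_form p) 0
  | fexS p => triple 10 (num_form p) 0
  end.

Fixpoint num_list (l : list nat) : nat :=
  match l with
  | [] => triple 0 0 0
  | a :: l => triple 1 a (num_list l)
  end.

Definition num_op (o : operation) : nat :=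
  match o with
  | onat => 0 | opairs => 1 | omeet => 2 | opairs2 => 3 | omeet2 => 4 | odiag => 5
  | onbhd b => 6 + bit b | oboxes => 8 | ocaught => 9 | obranch => 10
  end.

Definition num_label (l : label) : nat :=
  match l with
  | lform p q ns => triple 0 (num_form p) (triple 0 (num_form q) (num_list ns))
  | lop o => triple 1 (num_op o) 0
  | lpath => triple 2 0 0
  | lbound => triple 3 0 0
  | lsome x => triple 4 x 0
  end.

Fixpoint num_code (c : code) : nat :=
  match c with
  | coracle => triple 0 0 0
  | cleft c => triple 1 (num_code c) 0
  | ccons a c => triple 2 (num_code a) (num_code c)
  | cenum l c => triple 3 (num_label l) (num_code c)
  | call c => triple 4 (num_code c) 0
  end.

Ltac untriple :=
  repeat match goal with
  | H : triple _ _ _ = triple _ _ _ |- _ =>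
      apply triple_inj in H; destruct H as (? & ? & ?); try discriminate
  end.

Lemma num_term_inj s : forall t, num_term s = num_term t -> s = t.
Proof. induction s; intros []; simpl; intros; untriple; f_equal; auto. Qed.

Lemma num_form_inj p : forall q, num_form p = num_form q -> p = q.
Proof.
  pose proof num_term_inj.
  induction p; intros []; simpl; intros; untriple; f_equal; auto.
Qed.

Lemma num_list_inj l : forall l', num_list l = num_list l' -> l = l'.
Proof. induction l; intros []; simpl; intros; untriple; f_equal; auto. Qed.

Lemma num_label_inj l l' : num_label l = num_label l' -> l = l'.
Proof.
  pose proof num_form_inj. pose proof num_list_inj.
  destruct l as [| o | | |], l' as [| o' | | |]; simpl; intros; untriple; f_equal; auto.
  destruct o as [| | | | | |[]| | |], o' as [| | | | | |[]| | |]; easy.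
Qed.

Lemma num_code_inj c : forall c', num_code c = num_code c' -> c = c'.
Proof.
  pose proof num_label_inj.
  induction c; intros []; simpl; intros; untriple; f_equal; auto.
Qed.

(** Lists all codes, so that a construction in countably many steps can treat each of them;
    [coracle] fills the places of numbers that code nothing. *)
Definition nth_code (n : nat) : code :=
  match excluded_middle_informative (exists c, num_code c = n) with
  | left H => proj1_sig (constructive_indefinite_description _ H)
  | right _ => coracle
  end.

Lemma nth_num_code c : nth_code (num_code c) = c.
Proof.
  unfold nth_code. destruct excluded_middle_informative as [H|H].
  - destruct constructive_indefinite_description as [c' Hc]. now apply num_code_inj.
  - destruct H. eauto.
Qed.

(** * Undominated functions *)

(** Outputs need not be unique: whichever value a search at [x] finds first must be a bound, so that
    the search computes a dominating function. *)
Definition dominates (c : code) (Z : set) (f : nat -> nat) : Prop :=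
  (forall x, exists n, den c 0 true Z (pr x n))
  /\ (forall x n, den c 0 true Z (pr x n) -> f x <= n).

Definition undominated (e : bool -> nat -> nat) (Z : set) : Prop :=
  forall b c, ~ dominates c Z (e b).

(** * The finite-extension construction *)

Definition structure : Type := bool -> nat -> nat -> nat -> Prop.

(** [S b w x n] says that w lies in S_b(x,n). By the last two clauses neighbourhoods shrink as n
    grows, and a neighbourhood of y containing another point x contains every neighbourhood of x. *)
Definition coherent (S : structure) : Prop :=
  (forall b w x n, S b w x n -> x < w /\ n < w)
  /\ (forall b w x n m, S b w x n -> m <= n -> S b w x m)
  /\ (forall b w x y m n, S b x y m -> S b w x n -> S b w y m).

Definition settled (s : nat) (S : structure) (e : bool -> nat -> nat) : Prop :=
  forall b w x n, x < s -> s <= w -> (S b w x n <-> n < e b x).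

Definition separated (e : bool -> nat -> nat) : Prop :=
  forall x y, e true x <= x + y \/ e false y <= x + y.

Definition limits (S : structure) (e : bool -> nat -> nat) : Prop :=
  forall b x, exists s, forall w n, s <= w -> (S b w x n <-> n < e b x).

(** With [w] as outermost component, the oracle below t depends only on the part of [S] with w <
    t. *)
Definition oracle (S : structure) : set :=
  fun v => exists b w x n, v = pr w (pr (pr x n) (bit b)) /\ S b w x n.

Lemma oracle_pr S b w x n : oracle S (pr w (pr (pr x n) (bit b))) <-> S b w x n.
Proof.
  split.
  - intros (b' & w' & x' & n' & H & HS). pr_inj. apply bit_inj in H0 as ->. easy.
  - intros H. unfold oracle. eauto 6.
Qed.

Lemma oracle_agree S S' t :
  (forall b w x n, w < t -> (S b w x n <-> S' b w x n)) ->
  agree t (oracle S) (oracle S').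
Proof.
  intros H v Hv.
  split; intros (b & w & x & n & -> & HS);
    pose proof (pr_ge_l w (pr (pr x n) (bit b)));
    (exists b, w, x, n; split; [easy|]; apply H; [lia|easy]).
Qed.

(** A forcing condition. Only the parts of [struct] and [value] below [stage] restrict later
    structures; the rest of [struct] is a default continuation, in which all limits are reached at
    [stage]. *)
Record condition : Type := Condition {
  stage : nat;
  struct : structure;
  value : bool -> nat -> nat
}.

(** Since [stage p] bounds all values so far, the next large value can be placed at the point
    [stage p]. *)
Definition valid (p : condition) : Prop :=
  coherent (struct p) /\ settled (stage p) (struct p) (value p)
  /\ (forall b x, x < stage p -> value p b x <= stage p)
  /\ (forall x, stage p <= x -> forall b, value p b x = 0)
  /\ separated (value p).

Definition respects (p : condition) (S : structure) : Prop :=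
  (forall b w x n, w < stage p -> (S b w x n <-> struct p b w x n))
  /\ settled (stage p) S (value p).

Definition stronger (p q : condition) : Prop :=
  stage p < stage q /\ respects p (struct q)
  /\ (forall b x, x < stage p -> value q b x = value p b x).

(* From stage [t] on, the structure [S] is replaced by its prediction, where
   [stage p] gets the value [t] in the component [b]. *)
Definition extension (p : condition) (S : structure) (t : nat) (b : bool) : condition :=
  let v b' x := if lt_dec x (stage p) then value p b' x
                else if Nat.eq_dec x (stage p)
                     then if Bool.eqb b' b then t else 0 else 0 in
  Condition t (fun b' w x n => (w < t /\ S b' w x n) \/ (t <= w /\ n < v b' x)) v.

(** Separation survives because the new value sits at a point bounding all earlier values, while the
    other component is 0 from that point on. *)
Lemma extension_valid p S t b :
  valid p -> coherent S -> respects p S -> stage p < t ->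
  valid (extension p S t b) /\ stronger p (extension p S t b)
  /\ value (extension p S t b) b (stage p) = t.
Proof.
  intros (Hc & Hs & Hle & Hz & Hsep) (C1 & C2 & C3) (R1 & R2) Ht.
  set (q := extension p S t b).
  assert (Hv1 : forall b' x, x < stage p -> value q b' x = value p b' x).
  { intros b' x Hx. simpl. destruct lt_dec; [easy|lia]. }
  assert (Hv2 : value q b (stage p) = t).
  { simpl. destruct lt_dec; [lia|]. destruct Nat.eq_dec; [|lia]. now rewrite Bool.eqb_reflx. }
  assert (Hv3 : forall b' x, stage p < x -> value q b' x = 0).
  { intros b' x Hx. simpl. destruct lt_dec; [lia|]. destruct Nat.eq_dec; [lia|easy]. }
  assert (Hv4 : forall b' x, stage p <= x -> b' <> b -> value q b' x = 0).
  { intros b' x Hx Hb. simpl. destruct lt_dec; [lia|]. destruct Nat.eq_dec; [|easy].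
    destruct (Bool.eqb b' b) eqn:E; [|easy]. now apply Bool.eqb_prop in E. }
  assert (Hv5 : forall b' x, value q b' x <= t).
  { intros b' x. destruct (lt_eq_lt_dec x (stage p)) as [[Hx|Hx]|Hx].
    - rewrite Hv1 by easy. specialize (Hle b' x Hx). lia.
    - destruct (Bool.bool_dec b' b) as [->|Hb]; [subst x; lia|].
      rewrite Hv4 by (lia || easy). lia.
    - rewrite Hv3 by easy. lia. }
  assert (HS : forall b' w x n, struct q b' w x n <->
    (w < t /\ S b' w x n) \/ (t <= w /\ n < value q b' x)) by reflexivity.
  assert (Hst : stage q = t) by reflexivity.
  clearbody q. split; [|split; [|easy]].
  - split; [split; [|split]|split; [|split; [|split]]].
    + intros b' w x n H. split.
      { apply HS in H as [[H1 H2]|[H1 H2]]; [now apply C1 in H2|].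
        destruct (le_lt_dec x (stage p)); [lia|]. rewrite Hv3 in H2; lia. }
      apply HS in H as [[H1 H2]|[H1 H2]]; [now apply C1 in H2|].
      specialize (Hv5 b' x). lia.
    + intros b' w x n m H Hm. apply HS. apply HS in H as [[H1 H2]|[H1 H2]]; [left|right; lia].
      split; [easy|]. now apply C2 with n.
    + intros b' w x y m n Hxy Hwx. apply HS. apply HS in Hwx as [[H1 H2]|[H1 H2]].
      * left. split; [easy|]. apply HS in Hxy as [[H3 H4]|[H3 H4]]; [now apply C3 with x n|].
        apply C1 in H2. lia.
      * right. split; [easy|].
        destruct (le_lt_dec x (stage p)) as [Hx|Hx]; [|rewrite Hv3 in H2; lia].
        apply HS in Hxy as [[_ Hxy]|[? _]]; [|lia].
        assert (Hy : y < x) by now apply C1 in Hxy.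
        rewrite Hv1 by lia.
        (* Both cases look at [S] at the number [stage p], where the limits of earlier centres are
           reached. If x is that number, [Hxy] is already such a fact; otherwise transitivity
           through x gives one. *)
        destruct (Nat.eq_dec x (stage p)) as [->|Hne].
        -- now apply (R2 b' (stage p) y m).
        -- apply (R2 b' (stage p) y m); [lia|lia|].
           apply (C3 _ _ x _ _ n); [easy|]. apply R2; [lia|lia|].
           now rewrite <- Hv1 by lia.
    + intros b' w x n _ Hw. rewrite Hst in Hw. rewrite HS. intuition lia.
    + intros b' x _. rewrite Hst. apply Hv5.
    + intros x Hx b'. rewrite Hst in Hx. apply Hv3. lia.
    + intros x y.
      destruct (lt_dec x (stage p)) as [Hx|Hx], (lt_dec y (stage p)) as [Hy|Hy].
      * rewrite !Hv1 by easy. apply Hsep.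
      * left. rewrite Hv1 by easy. specialize (Hle true x Hx). lia.
      * right. rewrite Hv1 by easy. specialize (Hle false y Hy). lia.
      * destruct b; [right|left]; rewrite Hv4; easy || lia.
  - split; [lia|]. split; [split|easy].
    + intros b' w x n Hw. rewrite HS, <- R1 by easy. split; [|left; split; [lia|easy]].
      intros [[_ H]|[H _]]; [easy|lia].
    + intros b' w x n Hx Hw. rewrite HS, Hv1 by easy.
      rewrite <- (R2 b' w x n) by easy. split; [intuition|].
      intros H. destruct (lt_dec w t); [now left|right; split; [lia|easy]].
Qed.

Lemma stronger_trans p q r : stronger p q -> stronger q r -> stronger p r.
Proof.
  intros (H1 & [H2 H3] & H4) (K1 & [K2 K3] & K4).
  split; [lia|]. split; [split|].
  - intros b w x n Hw. rewrite K2 by lia. now apply H2.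
  - intros b w x n Hx Hw. destruct (lt_dec w (stage q)).
    + rewrite K2 by easy. now apply H3.
    + rewrite <- H4 by easy. apply K3; lia.
  - intros b x Hx. now rewrite K4, H4 by lia.
Qed.

(** Either way [c] cannot dominate: an output below a value that is final, as [x < stage q], is
    forced, or all outputs at x are excluded. *)
Definition decides (q : condition) (b : bool) (c : code) (x : nat) : Prop :=
  (exists n, n < value q b x /\ x < stage q /\
     forall S, coherent S -> respects q S -> den c 0 true (oracle S) (pr x n))
  \/ (forall S, coherent S -> respects q S -> forall n, ~ den c 0 true (oracle S) (pr x n)).

(** The point is [stage p]. If some structure respecting [p] yields an output there, its finite use
    is frozen and a larger value is assigned. If none does, any extension works, since what respects
    it respects [p]. *)
Lemma decide p b c : valid p ->
  exists q, valid q /\ stronger p q /\ exists x, decides q b c x.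
Proof.
  intros Hp.
  destruct (classic (exists S n, coherent S /\ respects p S
                       /\ den c 0 true (oracle S) (pr (stage p) n)))
    as [(S & n & HS & HR & Hd)|H].
  - destruct (den_open _ _ _ _ _ Hd) as [B HB].
    (* Large enough to preserve the use [B] and, as the new value, to exceed the output [n]. *)
    set (t := stage p + B + n + 1).
    destruct (extension_valid p S t b Hp HS HR) as (Hv & Hst & Ht); [unfold t; lia|].
    exists (extension p S t b). split; [easy|]. split; [easy|].
    exists (stage p). left. exists n. rewrite Ht. split; [unfold t; lia|].
    split; [apply Hst|].
    intros S' _ [HR' _]. apply HB.
    apply agree_le with t; [unfold t; lia|]. apply oracle_agree.
    intros b' w x m Hw. rewrite HR' by easy. simpl. split; [now left|].
    intros [[_ ?]|[? _]]; [easy|lia].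
  - assert (HR : respects p (struct p)) by (split; [easy|apply Hp]).
    destruct (extension_valid p (struct p) (S (stage p)) b Hp) as (Hv & Hst & _);
      [apply Hp|easy|lia|].
    exists (extension p (struct p) (S (stage p)) b). split; [easy|]. split; [easy|].
    exists (stage p). right. intros S' HS' HR' n Hd. apply H. exists S', n.
    split; [easy|]. split; [|easy].
    destruct Hst as (H1 & [H2 H3] & H4), HR' as [K2 K3].
    split.
    + intros b' w x m Hw. rewrite K2 by lia. now apply H2.
    + intros b' w x m Hx Hw. destruct (lt_dec w (stage (extension p (struct p) (S (stage p)) b))) as [Hlt|Hge].
      * rewrite K2 by easy. now apply H3.
      * rewrite <- H4 by easy. apply K3; lia.
Qed.

Lemma generic_structure : exists S e,
  coherent S /\ separated e /\ limits S e /\ undominated e (oracle S).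
Proof.
  (* Step [j] treats the code numbered by half of [j] against the component given by the parity of
     [j]. *)
  destruct (dependent_choice (fun _ p => valid p)
    (fun j p q => stronger p q /\
       exists x, decides q (Nat.even j) (nth_code (Nat.div2 j)) x)
    (Condition 0 (fun _ _ _ _ => False) (fun _ _ => 0))) as (f & _ & Hv & Hf).
  { split; [|split; [|split; [|split]]]; simpl.
    - repeat split; easy.
    - intros b w x n; lia.
    - lia.
    - easy.
    - left; simpl; lia. }
  { intros j p Hp. destruct (decide p (Nat.even j) (nth_code (Nat.div2 j)) Hp)
      as (q & Hq & Hpq & Hd). eauto. }
  assert (Hstr : forall i j, i < j -> stronger (f i) (f j)).
  { intros i j Hij. induction Hij; [apply Hf|].
    eapply stronger_trans; [exact IHHij|apply Hf]. }
  assert (Hst : forall j, j <= stage (f j)).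
  { intros j. induction j as [|j IH]; [lia|].
    destruct (Hf j) as [[H _] _]. lia. }
  (* The stage of [f (S w)] exceeds [w], so this condition has already fixed the structure at [w];
     likewise for the values. *)
  set (S0 := fun b w x n => struct (f (S w)) b w x n).
  set (e := fun b x => value (f (S x)) b x).
  assert (HS0 : forall j b w x n, w < stage (f j) -> (S0 b w x n <-> struct (f j) b w x n)).
  { intros j b w x n Hw. unfold S0. specialize (Hst (S w)).
    destruct (lt_eq_lt_dec (S w) j) as [[Hl|<-]|Hl]; [|easy|].
    - symmetry. now apply Hstr.
    - now apply Hstr. }
  assert (He : forall j b x, x < stage (f j) -> value (f j) b x = e b x).
  { intros j b x Hx. unfold e. specialize (Hst (S x)).
    destruct (lt_eq_lt_dec (S x) j) as [[Hl|<-]|Hl]; [|easy|].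
    - now apply Hstr.
    - symmetry. now apply Hstr. }
  assert (HR : forall j, respects (f j) S0).
  { intros j. split.
    - intros; now apply HS0.
    - intros b w x n Hx Hw. destruct (lt_dec j (S w)) as [Hj|Hj].
      + apply (Hstr _ _ Hj); easy.
      + specialize (Hst j). lia. }
  assert (HC : coherent S0).
  { split; [|split].
    - intros b w x n H. exact (proj1 (proj1 (Hv (S w))) b w x n H).
    - intros b w x n m H Hm. exact (proj1 (proj2 (proj1 (Hv (S w)))) b w x n m H Hm).
    - intros b w x y m n Hxy Hwx.
      assert (x < w) by apply (proj1 (proj1 (Hv (S w))) b w x n Hwx).
      assert (Hw := Hst (S w)).
      apply (HS0 (S w)) in Hxy; [|lia].
      exact (proj2 (proj2 (proj1 (Hv (S w)))) b w x y m n Hxy Hwx). }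
  exists S0, e. split; [easy|]. split; [|split].
  - intros x y. assert (H := Hst (S (x + y))).
    rewrite <- (He (S (x + y)) true x), <- (He (S (x + y)) false y) by lia.
    apply Hv.
  - intros b x. exists (stage (f (S x))). intros w n Hw.
    specialize (Hst (S x)). apply (HR (S x)); [lia|easy].
  - intros b c [Htot Hdom].
    set (j := 2 * num_code c + if b then 0 else 1).
    assert (Hb : Nat.even j = b).
    { unfold j. destruct b; [now rewrite Nat.add_0_r, Nat.even_even|apply Nat.even_odd]. }
    assert (Hc : Nat.div2 j = num_code c).
    { unfold j. destruct b; [now rewrite Nat.add_0_r, Nat.div2_double|].
      now rewrite Nat.add_1_r, Nat.div2_succ_double. }
    destruct (Hf j) as [_ [x Hx]]. rewrite Hb, Hc, nth_num_code in Hx.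
    destruct Hx as [(n & Hn & Hlt & Hd)|Hd].
    + specialize (Hd S0 HC (HR _)). specialize (Hdom x n Hd).
      rewrite He in Hn by easy. lia.
    + destruct (Htot x) as [n Hn]. now apply (Hd S0 HC (HR _) n).
Qed.

(** * A basis theorem: members of closed sets that add no dominating function *)

Lemma enum_bound_iff a k Z x n :
  den (cenum lbound (ccons a k)) 0 true Z (pr x n) <->
  (exists m, m <= n /\ den a 0 true Z (pr x m)) \/ den k 0 true Z 0.
Proof.
  simpl. split.
  - intros (D & [(x' & m & n' & H & Hm & Hin)|Hin] & HD).
    + pr_inj. left. exists m. split; [easy|]. now apply HD in Hin.
    + right. now apply HD in Hin.
  - intros [(m & Hm & H)|H].
    + exists [(0, true, pr x m)]. split.
      * left. exists x, m, n. simpl; auto.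
      * intros i b w [[= <- <- <-]|[]]. easy.
    + exists [(1, true, 0)]. split; [right; now left|].
      intros i b w [[= <- <- <-]|[]]. easy.
Qed.

Lemma enum_some_iff a k Z x v :
  den (cenum (lsome x) (ccons a k)) 0 true Z v <->
  (exists n, den a 0 true Z (pr x n)) \/ den k 0 true Z 0.
Proof.
  simpl. split.
  - intros (D & [(n & Hin)|Hin] & HD).
    + left. exists n. now apply HD in Hin.
    + right. now apply HD in Hin.
  - intros [(n & H)|H].
    + exists [(0, true, pr x n)]. split; [left; exists n; now left|].
      intros i b w [[= <- <- <-]|[]]. easy.
    + exists [(1, true, 0)]. split; [right; now left|].
      intros i b w [[= <- <- <-]|[]]. easy.
Qed.

(* [k] denotes the complement of a closed set of [P]. *)
Definition avoids (k : code) (Z : set) (P : nat -> bool) : Prop :=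
  ~ den k 0 true (join Z P) 0.

Lemma avoids_open k Z P : ~ avoids k Z P ->
  exists n, forall P', extends (pre P n) P' -> ~ avoids k Z P'.
Proof.
  intros H. apply NNPP in H. destruct (den_open _ _ _ _ _ H) as [B HB].
  exists B. intros P' HP' Ha. apply Ha, HB, agree_join; [now intros v|].
  intros i Hi. symmetry. now apply (extends_pre P P' B).
Qed.

Lemma extends_cases (s : list bool) (R : (nat -> bool) -> Prop) :
  (forall P, extends (s ++ [true]) P -> R P) ->
  (forall P, extends (s ++ [false]) P -> R P) -> forall P, extends s P -> R P.
Proof.
  intros H1 H0 P Hs. apply extends_snoc in Hs. destruct (P (length s)); auto.
Qed.

(** Along each sequence a finite prefix either yields an output or shows that the sequence leaves
    the closed set; [fan] makes the bound uniform. *)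
Lemma bounded_witness a k Z x :
  (forall P, avoids k Z P -> exists n, den a 0 true (join Z P) (pr x n)) ->
  exists N, forall P, avoids k Z P ->
    exists n, n <= N /\ den a 0 true (join Z P) (pr x n).
Proof.
  intros H.
  cut (exists N, forall P, extends [] P -> avoids k Z P ->
         exists n, n <= N /\ den a 0 true (join Z P) (pr x n)).
  { intros [N HN]. exists N. intros P. now apply HN. }
  apply (fan (fun s => exists N, forall P, extends s P -> avoids k Z P ->
                exists n, n <= N /\ den a 0 true (join Z P) (pr x n))).
  - intros s [N1 H1] [N0 H0]. exists (max N1 N0). refine (extends_cases _ _ _ _).
    + intros P Hs Ha. destruct (H1 P Hs Ha) as (n & Hn & Hd). exists n. split; [lia|easy].
    + intros P Hs Ha. destruct (H0 P Hs Ha) as (n & Hn & Hd). exists n. split; [lia|easy].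
  - intros P. destruct (classic (avoids k Z P)) as [Ha|Ha].
    + destruct (H P Ha) as [n Hd]. destruct (den_open _ _ _ _ _ Hd) as [B HB].
      exists B, n. intros P' HP' _. exists n. split; [easy|].
      apply HB, agree_join; [now intros v|].
      intros i Hi. symmetry. now apply (extends_pre P P' B).
    + destruct (avoids_open _ _ _ Ha) as [n Hn]. exists n, 0. intros P' HP' Ha'.
      now destruct (Hn P' HP').
Qed.

(** Compactness again: if the intersection were empty, each sequence would leave some closed set
    after a finite prefix, and by [fan] a single one of the sets would be empty. *)
Lemma nested_avoids (k : nat -> code) Z :
  (forall j P, avoids (k (S j)) Z P -> avoids (k j) Z P) ->
  (forall j, exists P, avoids (k j) Z P) -> exists P, forall j, avoids (k j) Z P.
Proof.
  intros Hdec Hne. apply NNPP; intros Hno.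
  assert (Hle : forall i j P, i <= j -> avoids (k j) Z P -> avoids (k i) Z P).
  { intros i j P Hij. induction Hij; auto. }
  cut (exists j, forall P, extends [] P -> ~ avoids (k j) Z P).
  { intros [j Hj]. destruct (Hne j) as [P HP]. now apply (Hj P). }
  apply (fan (fun s => exists j, forall P, extends s P -> ~ avoids (k j) Z P)).
  - intros s [j1 H1] [j0 H0]. exists (max j1 j0). refine (extends_cases _ _ _ _).
    + intros P Hs Ha. apply (H1 P Hs). revert Ha. apply Hle. lia.
    + intros P Hs Ha. apply (H0 P Hs). revert Ha. apply Hle. lia.
  - intros P.
    destruct (classic (exists j, ~ avoids (k j) Z P)) as [[j Hj]|H].
    + destruct (avoids_open _ _ _ Hj) as [n Hn]. now exists n, j.
    + destruct Hno. exists P. intros j. apply NNPP; intros Hj. apply H; eauto.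
Qed.

(** A decreasing sequence of closed sets treats all codes. A code that keeps outputs everywhere on
    its class has bounds valid for the whole class, and these can be enumerated from [Z] alone; so
    domination over the new oracle would give domination over [Z]. *)
Lemma undominated_basis e Z k0 : undominated e Z -> (exists P, avoids k0 Z P) ->
  exists P, avoids k0 Z P /\ undominated e (join Z P).
Proof.
  intros Hund Hne.
  destruct (dependent_choice (fun _ k => exists P, avoids k Z P)
    (fun j k k' =>
       (forall P, avoids k' Z P -> avoids k Z P) /\
       ((exists x, forall P, avoids k' Z P ->
           forall n, ~ den (nth_code j) 0 true (join Z P) (pr x n))
        \/ (forall x P, avoids k Z P ->
              exists n, den (nth_code j) 0 true (join Z P) (pr x n))))
    k0) as (k & Hk0 & Hk & HR).
  { exact Hne. }
  { intros j k Hk.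
    (* If some members of the class give the code no output at some x, the class shrinks to them;
       otherwise it is kept. *)
    destruct (classic (exists x P, avoids (cenum (lsome x) (ccons (nth_code j) k)) Z P))
      as [(x & P & HP)|H].
    - exists (cenum (lsome x) (ccons (nth_code j) k)). split; [eauto|].
      assert (HA : forall P, avoids (cenum (lsome x) (ccons (nth_code j) k)) Z P ->
        (forall n, ~ den (nth_code j) 0 true (join Z P) (pr x n)) /\ avoids k Z P).
      { intros P' Ha. unfold avoids in Ha. rewrite enum_some_iff in Ha.
        split; [intros n Hn; apply Ha; eauto|intros Hd; apply Ha; eauto]. }
      split; [intros P' Ha; now apply HA|]. left. exists x. intros P' Ha. now apply HA.
    - exists k. split; [easy|]. split; [easy|]. right. intros x P Ha.
      apply NNPP; intros Hno. apply H. exists x, P. unfold avoids.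
      rewrite enum_some_iff. intros [Hd|Hd]; [easy|]. now apply Ha. }
  destruct (nested_avoids k Z) as [P HP]; [intros j; apply HR|exact Hk|].
  exists P. split; [now rewrite <- Hk0|].
  intros b c [Htot Hdom]. destruct (HR (num_code c)) as [_ Hc].
  rewrite nth_num_code in Hc. destruct Hc as [[x Hx]|Hc].
  - destruct (Htot x) as [n Hn]. now apply (Hx P (HP _) n).
  - set (kc := k (num_code c)) in *.
    (* [call] collects the uniform bounds: outside the class everything is enumerated, so only
       members of the class impose a restriction. *)
    assert (HR' : forall x n, den (call (cenum lbound (ccons c kc))) 0 true Z (pr x n) <->
      forall P, avoids kc Z P -> exists m, m <= n /\ den c 0 true (join Z P) (pr x m)).
    { intros x n. change (den (call ?d) 0 true Z ?v)
        with (forall P, den d 0 true (join Z P) v).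
      split; intros H P'; specialize (H P'); rewrite ?enum_bound_iff in *.
      - intros Ha. destruct H as [H|H]; [easy|]. now destruct Ha.
      - destruct (classic (avoids kc Z P')) as [Ha|Ha]; [left; auto|right].
        now apply NNPP in Ha. }
    apply (Hund b (call (cenum lbound (ccons c kc)))). split.
    + intros x. destruct (bounded_witness c kc Z x) as [N HN]; [apply Hc|].
      exists N. now apply HR'.
    + intros x n H. rewrite HR' in H. destruct (H P (HP _)) as (m & Hm & Hd).
      specialize (Hdom x m Hd). lia.
Qed.

(** * The model *)

(** Set 0 is the tree and set 1 the join itself, whose odd half spells out [P]. Avoiding this code
    therefore means being a path. *)
Lemma enum_path_iff c Z T P v : represents c 0 Z T ->
  (den (cenum lpath (ccons (cleft c) coracle)) 0 true (join Z P) v <->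
   exists n, ~ T (seqcode (pre P n))).
Proof.
  intros Hc.
  assert (Hc' := represents_left c 0 Z P T Hc).
  split.
  - intros (D & (s & Hs & Hbits) & HD).
    assert (Hpre : pre P (length s) = s).
    { apply (nth_ext _ _ false false); rewrite length_pre; [easy|].
      intros i Hi. rewrite nth_pre by easy. specialize (HD _ _ _ (Hbits i Hi)).
      change (if nth i s false then join Z P (2 * i + 1) else ~ join Z P (2 * i + 1)) in HD.
      rewrite join_odd in HD. destruct (nth i s false), (P i); easy. }
    exists (length s). rewrite Hpre. apply Hc'. exact (HD _ _ _ Hs).
  - intros [n Hn].
    exists ((0, false, seqcode (pre P n)) :: map (fun i => (1, P i, 2 * i + 1)) (seq 0 n)).
    split.
    + exists (pre P n). split; [now left|]. rewrite length_pre. intros i Hi. right.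
      rewrite nth_pre by easy. apply in_map_iff. exists i. split; [easy|]. apply in_seq. lia.
    + intros i b w [[= <- <- <-]|Hin].
      * apply Hc'. exact Hn.
      * apply in_map_iff in Hin as (j & [= <- <- <-] & _).
        change (if P j then join Z P (2 * j + 1) else ~ join Z P (2 * j + 1)).
        rewrite join_odd. destruct (P j); easy.
Qed.

(** Undoes [n] joins, so that a code over an early oracle of the tower serves over a later one. *)
Definition lift (n : nat) (c : code) : code := Nat.iter n cleft c.

(* Stage [j] of the construction handles the tree with the code numbered [m]
   over the oracle [i], where [j] codes [(i, m)], so [i <= j]. *)
Definition task (j : nat) : code :=
  let (i, m) := Cantor.of_nat j in
  cenum lpath (ccons (cleft (lift (j - i) (nth_code m))) coracle).

(** The proviso allows for trees without a path; at such a step the added set only has to preserve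
    undomination. *)
Definition tower (e : bool -> nat -> nat) (Zs : nat -> set) : Prop :=
  (forall j, undominated e (Zs j))
  /\ (forall j, exists P, Zs (S j) = join (Zs j) P
        /\ ((exists P', avoids (task j) (Zs j) P') -> avoids (task j) (Zs j) P)).

Lemma tower_exists e Z : undominated e Z -> exists Zs, tower e Zs /\ Zs 0 = Z.
Proof.
  intros HZ.
  destruct (dependent_choice (fun _ Z => undominated e Z)
    (fun j Z Z' => exists P, Z' = join Z P
        /\ ((exists P', avoids (task j) Z P') -> avoids (task j) Z P)) Z)
    as (Zs & H0 & H1 & H2).
  { exact HZ. }
  { clear Z HZ. intros j Z HZ.
    destruct (classic (exists P', avoids (task j) Z P')) as [Hne|Hno].
    - destruct (undominated_basis e Z (task j) HZ Hne) as (P & HP & Hu).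
      exists (join Z P). split; [easy|]. eauto.
    (* No path exists, so the closed set is taken to be the whole space: a false formula is never
       enumerated from correct information. *)
    - destruct (undominated_basis e Z (cenum (lform fbot fbot []) coracle) HZ)
        as (P & _ & Hu).
      { exists (fun _ => true). intros (D & HD & Hv).
        apply (HD (fun _ => join Z (fun _ => true))).
        intros i b w Hin. specialize (Hv i b w Hin). simpl in Hv.
        destruct b; intuition congruence. }
      exists (join Z P). split; [easy|]. exists P. split; [easy|]. tauto. }
  exists Zs. split; [split; auto|easy].
Qed.

Definition model (Zs : nat -> set) (Y : set) : Prop :=
  exists j c, represents c 0 (Zs j) Y.

Lemma represents_lift e Zs n c i j Y : tower e Zs ->
  represents c i (Zs j) Y -> represents (lift n c) i (Zs (n + j)) Y.
Proof.
  intros [_ Ht] H. induction n as [|n IH]; [easy|].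
  destruct (Ht (n + j)) as (P & HP & _). simpl Nat.add. rewrite HP.
  now apply represents_left.
Qed.

Lemma represents_lift_le e Zs c i j k Y : tower e Zs -> j <= k ->
  represents c i (Zs j) Y -> represents (lift (k - j) c) i (Zs k) Y.
Proof.
  intros Ht Hk H. replace k with (k - j + j) at 2 by lia. now apply (represents_lift e).
Qed.

(** Finitely many sets of the model are represented over one common oracle; the places from [K] on
    are filled with [Zs 0] to make an infinite sequence. *)
Lemma model_env e Zs : tower e Zs -> forall K E, (forall i, i < K -> model Zs (E i)) ->
  exists j c E', (forall i, i < K -> E' i = E i)
                 /\ forall i, represents c i (Zs j) (E' i).
Proof.
  intros Ht K. induction K as [|K IH]; intros E HE.
  - exists 0, coracle, (fun _ => Zs 0). split; [lia|].
    intros i. apply represents_oracle.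
  - destruct (HE 0) as (j0 & c0 & H0); [lia|].
    destruct (IH (fun i => E (S i))) as (j & c & E' & HE' & Hc).
    { intros i Hi. apply HE. lia. }
    exists (max j0 j), (ccons (lift (max j0 j - j0) c0) (lift (max j0 j - j) c)),
      (scons (E 0) E').
    split; [intros [|i] Hi; [easy|apply HE'; lia]|].
    intros [|i].
    + change (represents (lift (max j0 j - j0) c0) 0 (Zs (max j0 j)) (E 0)).
      apply (represents_lift_le e); [easy|lia|easy].
    + change (represents (lift (max j0 j - j) c) i (Zs (max j0 j)) (E' i)).
      apply (represents_lift_le e); [easy|lia|easy].
Qed.

Definition continuous (o : operation) : Prop :=
  forall v E, open_at (fun E => interp o (E 0) (E 1) v) E
              /\ open_at (fun E => ~ interp o (E 0) (E 1) v) E.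

Lemma model_op e Zs o Y0 Y1 : tower e Zs -> continuous o ->
  model Zs Y0 -> model Zs Y1 -> model Zs (interp o Y0 Y1).
Proof.
  intros Ht Ho H0 H1.
  destruct (model_env e Zs Ht 2 (scons Y0 (scons Y1 (fun _ => Y0)))) as (j & c & E & HE & Hc).
  { intros [|[|i]] Hi; simpl; easy || lia. }
  exists j, (cenum (lop o) c). intros v.
  rewrite <- (HE 0 ltac:(lia) : _ = Y0), <- (HE 1 ltac:(lia) : _ = Y1).
  split; apply (enum_open c (Zs j) E); auto; apply Ho.
Qed.

Lemma eval_support t : exists K, forall (N N' : nat -> nat), (forall i, i < K -> N i = N' i) ->
  eval N t = eval N' t.
Proof.
  induction t as [n| | |s [K1 H1] t [K2 H2]|s [K1 H1] t [K2 H2]].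
  - exists (S n). intros N N' H. apply H. lia.
  - now exists 0.
  - now exists 0.
  - exists (max K1 K2). intros N N' H. simpl.
    rewrite (H1 N N'), (H2 N N'); [easy|intros; apply H; lia..].
  - exists (max K1 K2). intros N N' H. simpl.
    rewrite (H1 N N'), (H2 N N'); [easy|intros; apply H; lia..].
Qed.

(** This lets a label carry the number parameters as a finite list. *)
Lemma sat_support p : exists K, forall M (N N' : nat -> nat) E, (forall i, i < K -> N i = N' i) ->
  (sat M N E p <-> sat M N' E p).
Proof.
  assert (Hs : forall K (N N' : nat -> nat), (forall i, i < K -> N i = N' i) ->
            forall x i, i < K -> scons x N i = scons x N' i).
  { intros K N N' H x [|i] Hi; [easy|]. apply H. lia. }
  induction p as [|s t|s t|t X|p [K1 H1] q [K2 H2]|p [K1 H1] q [K2 H2]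
    |p [K1 H1] q [K2 H2]|p [K HK]|p [K HK]|p [K HK]|p [K HK]].
  - now exists 0.
  - destruct (eval_support s) as [K1 H1], (eval_support t) as [K2 H2].
    exists (max K1 K2). intros M N N' E H. simpl.
    rewrite (H1 N N'), (H2 N N'); [easy|intros; apply H; lia..].
  - destruct (eval_support s) as [K1 H1], (eval_support t) as [K2 H2].
    exists (max K1 K2). intros M N N' E H. simpl.
    rewrite (H1 N N'), (H2 N N'); [easy|intros; apply H; lia..].
  - destruct (eval_support t) as [K HK]. exists K. intros M N N' E H. simpl.
    now rewrite (HK N N').
  - exists (max K1 K2). intros M N N' E H. simpl.
    rewrite (H1 M N N'), (H2 M N N'); [easy|intros; apply H; lia..].
  - exists (max K1 K2). intros M N N' E H. simpl.
    rewrite (H1 M N N'), (H2 M N N'); [easy|intros; apply H; lia..].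
  - exists (max K1 K2). intros M N N' E H. simpl.
    rewrite (H1 M N N'), (H2 M N N'); [easy|intros; apply H; lia..].
  - exists K. intros M N N' E H. simpl.
    split; intros Hx x; apply (HK M _ _ E (Hs _ _ _ H x)), Hx.
  - exists K. intros M N N' E H. simpl.
    split; intros [x Hx]; exists x; apply (HK M _ _ E (Hs _ _ _ H x)), Hx.
  - exists K. intros M N N' E H. simpl.
    split; intros Hx Y HY; apply (HK M N N'); auto.
  - exists K. intros M N N' E H. simpl.
    split; intros [Y [HY Hx]]; exists Y; (split; [easy|]); apply (HK M N N'); auto.
Qed.

Definition agree_on (K B : nat) (E E' : nat -> set) : Prop :=
  forall i, i < K -> agree B (E i) (E' i).

Lemma agree_on_le K B K' B' E E' :
  K <= K' -> B <= B' -> agree_on K' B' E E' -> agree_on K B E E'.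
Proof. intros HK HB H i Hi. apply agree_le with B'; [easy|]. apply H. lia. Qed.

(** The bound [B] may vary with the environment, but [K] depends on the formula alone. The class may
    change too, which connects [everything] with the model. *)
Definition local_below (K : nat) (p : form) : Prop :=
  forall N E, exists B, forall M M' E', agree_on K B E E' ->
    (sat M N E p <-> sat M' N E' p).

Lemma local_below_le K K' p : K <= K' -> local_below K p -> local_below K' p.
Proof.
  intros HK H N E. destruct (H N E) as [B HB]. exists B. intros M M' E' HE.
  apply HB. now apply agree_on_le with K' B.
Qed.

Lemma local_bounded K p N E b : local_below K p -> exists B, forall x M M' E',
  x < b -> agree_on K B E E' -> (sat M (scons x N) E p <-> sat M' (scons x N) E' p).
Proof.
  intros H. induction b as [|b [B1 HB1]].
  - exists 0. lia.
  - destruct (H (scons b N) E) as [B2 HB2]. exists (max B1 B2).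
    intros x M M' E' Hx HE. destruct (Nat.eq_dec x b) as [->|Hn].
    + apply HB2. apply agree_on_le with K (max B1 B2); lia || easy.
    + apply HB1; [lia|]. apply agree_on_le with K (max B1 B2); lia || easy.
Qed.

Lemma Delta00_local p : Delta00 p -> exists K, local_below K p.
Proof.
  assert (Hop : forall (op : form -> form -> form) (f : Prop -> Prop -> Prop) p q,
    (forall M N E, sat M N E (op p q) <-> f (sat M N E p) (sat M N E q)) ->
    (forall P P' Q Q', (P <-> P') -> (Q <-> Q') -> (f P Q <-> f P' Q')) ->
    (exists K, local_below K p) -> (exists K, local_below K q) ->
    exists K, local_below K (op p q)).
  { intros op f p' q' Hsat Hf [K1 H1] [K2 H2]. exists (max K1 K2). intros N E.
    destruct (H1 N E) as [B1 HB1], (H2 N E) as [B2 HB2]. exists (max B1 B2).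
    intros M M' E' HE. rewrite !Hsat. apply Hf.
    - apply HB1. apply agree_on_le with (max K1 K2) (max B1 B2); lia || easy.
    - apply HB2. apply agree_on_le with (max K1 K2) (max B1 B2); lia || easy. }
  induction 1 as [|s t|s t|t X|p q Hp IHp Hq IHq|p q Hp IHp Hq IHq|p q Hp IHp Hq IHq
                  |t p Hp [K HK]|t p Hp [K HK]].
  - exists 0. intros N E. now exists 0.
  - exists 0. intros N E. now exists 0.
  - exists 0. intros N E. now exists 0.
  - exists (S X). intros N E. exists (S (eval N t)). intros M M' E' HE.
    apply HE; lia.
  - apply (Hop fimp (fun P Q => P -> Q)); auto; [easy|tauto].
  - apply (Hop fand and); auto; [easy|tauto].
  - apply (Hop for_ or); auto; [easy|tauto].
  - exists K. intros N E. destruct (local_bounded K p N E (eval N t) HK) as [B HB].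
    exists B. intros M M' E' HE. simpl.
    split; intros H x Hx; rewrite eval_shift in Hx; apply (HB x M M' E'); auto;
      apply H; now rewrite eval_shift.
  - exists K. intros N E. destruct (local_bounded K p N E (eval N t) HK) as [B HB].
    exists B. intros M M' E' HE. simpl.
    split; intros (x & Hx & H); exists x; (split; [easy|]);
      rewrite eval_shift in Hx; apply (HB x M M' E'); auto.
Qed.

(** The existential formula gives the positive enumeration and the negation of the universal one the
    negative; a witness for either uses only finite parts of the sets. *)
Lemma model_comprehension e Zs p q N E : tower e Zs -> Sigma01 p -> Pi01 q ->
  (forall i, model Zs (E i)) ->
  (forall x, sat (model Zs) (scons x N) E p <-> sat (model Zs) (scons x N) E q) ->
  model Zs (fun x => sat (model Zs) (scons x N) E p).
Proof.
  intros Ht [p' Hp] [q' Hq] HE Heq.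
  destruct (Delta00_local p' Hp) as [K1 H1], (Delta00_local q' Hq) as [K2 H2].
  set (K := max K1 K2).
  apply (local_below_le _ K) in H1, H2; [|unfold K; lia..].
  destruct (sat_support (fexN p')) as [L1 HL1], (sat_support (fallN q')) as [L2 HL2].
  set (L := max L1 L2).
  set (ns := map N (seq 0 L)).
  assert (Hns : forall v i, i < L -> scons v (fun i => nth i ns 0) i = scons v N i).
  { intros v [|i] Hi; [easy|]. simpl. unfold ns.
    rewrite (nth_indep _ 0 (N 0)), map_nth, seq_nth by (rewrite ?length_map, ?length_seq; lia).
    easy. }
  destruct (model_env e Zs Ht K E (fun i _ => HE i)) as (j & c & E' & HE' & Hc).
  assert (Hag : forall B, agree_on K B E' E).
  { intros B i Hi. rewrite HE' by easy. now intros v. }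
  exists j, (cenum (lform (fexN p') (fallN q') ns) c). intros v.
  rewrite (Heq v) at 2.
  rewrite <- (HL1 (model Zs) (scons v (fun i => nth i ns 0)) (scons v N))
    by (intros; apply Hns; unfold L; lia).
  rewrite <- (HL2 (model Zs) (scons v (fun i => nth i ns 0)) (scons v N))
    by (intros; apply Hns; unfold L; lia).
  set (N' := scons v (fun i => nth i ns 0)).
  assert (HP : sat everything N' E' (fexN p') <-> sat (model Zs) N' E (fexN p')).
  { simpl. split; intros [x Hx]; exists x;
      destruct (H1 (scons x N') E') as [B HB]; apply (HB everything (model Zs) E); auto. }
  assert (HQ : sat everything N' E' (fallN q') <-> sat (model Zs) N' E (fallN q')).
  { simpl. split; intros Hx x;
      destruct (H2 (scons x N') E') as [B HB]; apply (HB everything (model Zs) E); auto. }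
  rewrite <- HP, <- HQ.
  assert (Hup : forall B E'', agreeS (max B K) E' E'' -> agree_on K B E' E'').
  { intros B E'' H i Hi. apply agree_le with (max B K); [lia|]. apply H. lia. }
  split.
  - apply (enum_open c (Zs j) E' (fun E => sat everything N' E (fexN p'))); [easy|].
    intros [x Hx]. destruct (H1 (scons x N') E') as [B HB]. exists (max B K).
    intros E'' HE''. exists x. apply (HB everything everything E''); auto.
  - apply (enum_open c (Zs j) E' (fun E => ~ sat everything N' E (fallN q'))); [easy|].
    intros H. apply not_all_ex_not in H as [x Hx].
    destruct (H2 (scons x N') E') as [B HB]. exists (max B K).
    intros E'' HE'' H. apply Hx. apply (HB everything everything E''); auto.
Qed.

Lemma continuous_of_bound o bd :
  (forall v E E', agreeS (bd v) E E' ->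
     (interp o (E 0) (E 1) v <-> interp o (E' 0) (E' 1) v)) -> continuous o.
Proof.
  intros H v E. split; intros HE; exists (bd v); intros E' HE';
    specialize (H v E E' HE'); tauto.
Qed.

Lemma agreeS_at B E E' i v : agreeS B E E' -> i < B -> v < B -> (E i v <-> E' i v).
Proof. intros H Hi Hv. now apply H. Qed.

Lemma continuous_branch : continuous obranch.
Proof.
  apply (continuous_of_bound _ (fun v => 2 * v + 2)). intros v E E' H.
  split; intros (n & b & -> & Hb); exists n, b; (split; [easy|]); rewrite Hb;
    pose proof (pr_ge_l n (bit b)); [|symmetry];
    apply (agreeS_at _ _ _ 0 (2 * n + 1) H); lia.
Qed.

Lemma continuous_nbhd b : continuous (onbhd b).
Proof.
  apply (continuous_of_bound _ (fun v => S (pr v (pr v 1)))). intros v E E' H.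
  assert (K : forall z x n, v = pr z (pr x n) ->
            (E 0 (pr z (pr (pr x n) (bit b))) <-> E' 0 (pr z (pr (pr x n) (bit b))))).
  { intros z x n Hv. apply (agreeS_at _ _ _ 0 _ H); [lia|].
    pose proof (pr_ge_l z (pr x n)). pose proof (pr_ge_r z (pr x n)).
    apply Nat.lt_succ_r, pr_mono; [lia|]. apply pr_mono; [lia|]. destruct b; simpl; lia. }
  split; intros (z & x & n & Hv & Hb); exists z, x, n; (split; [easy|]);
    specialize (K z x n Hv); tauto.
Qed.

Lemma continuous_boxes : continuous oboxes.
Proof.
  apply (continuous_of_bound _ (fun v => 2 + pr v v)). intros v E E' H.
  assert (K : forall x y i j, v = pr (pr x y) (pr i j) ->
            (E 0 (pr x i) <-> E' 0 (pr x i)) /\ (E 1 (pr y j) <-> E' 1 (pr y j))).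
  { intros x y i j Hv.
    pose proof (pr_ge_l x y). pose proof (pr_ge_r x y).
    pose proof (pr_ge_l i j). pose proof (pr_ge_r i j).
    pose proof (pr_ge_l (pr x y) (pr i j)). pose proof (pr_ge_r (pr x y) (pr i j)).
    split; apply (agreeS_at _ _ _ _ _ H); try lia;
      apply Nat.lt_lt_succ_r, Nat.lt_succ_r, pr_mono; lia. }
  split; intros (x & y & i & j & Hx & Hy & Hv); exists x, y, i, j;
    specialize (K x y i j Hv); tauto.
Qed.

Lemma model_oracle Zs j : model Zs (Zs j).
Proof. exists j, coracle. apply represents_oracle. Qed.

(** Koenig's lemma by [fan]: if every sequence left the tree, the codes of its members would be
    bounded. *)
Lemma bintree_infinite_path T : is_bintree T -> (forall m, exists n, m < n /\ T n) ->
  exists P, forall n, T (seqcode (pre P n)).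
Proof.
  intros [HT1 HT2] Hinf.
  assert (Hpre : forall s s', T (seqcode (s ++ s')) -> T (seqcode s)).
  { intros s s' H. apply (HT2 (seqcode (s ++ s')) _ (length s)).
    split; [easy|]. split; [apply seqcode_binseq|].
    intros p Hp. assert (Hp' := Hp). apply mem_fcode, in_seqgraph in Hp' as (i & Hi & ->).
    apply mem_seqcode. rewrite length_app, app_nth1 by easy. split; [lia|easy]. }
  apply NNPP; intros Hno.
  assert (Hfan : exists m, forall s, T (seqcode ([] ++ s)) -> seqcode ([] ++ s) <= m).
  { apply (fan (fun s => exists m, forall s', T (seqcode (s ++ s')) -> seqcode (s ++ s') <= m)).
    - intros s [m1 H1] [m0 H0]. exists (seqcode s + m1 + m0). intros [|b s'] H.
      + rewrite app_nil_r. lia.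
      + change (b :: s') with ([b] ++ s') in *. rewrite app_assoc in *.
        destruct b; [apply H1 in H|apply H0 in H]; lia.
    - intros P. destruct (classic (exists n, ~ T (seqcode (pre P n)))) as [[n Hn]|H].
      + exists n, 0. intros s' H. destruct Hn. now apply Hpre with s'.
      + destruct Hno. exists P. intros n. apply NNPP; intros Hn. apply H; eauto. }
  destruct Hfan as [m Hm]. destruct (Hinf m) as (n & Hn & HT).
  destruct (HT1 n HT) as [l Hl]. apply binseq_seqcode in Hl as (s & _ & ->).
  specialize (Hm s HT). simpl in Hm. lia.
Qed.

Lemma model_weak_konig e Zs T : tower e Zs -> model Zs T ->
  is_bintree T -> (forall m, exists n, m < n /\ T n) ->
  exists g, model Zs g /\ is_path T g.
Proof.
  intros Ht (i & c & Hc) HT Hinf.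
  destruct (bintree_infinite_path T HT Hinf) as [P0 HP0].
  (* The step of the tower whose task is exactly this tree. *)
  set (j := Cantor.to_nat (i, num_code c)).
  assert (Hij : i <= j).
  { pose proof (Cantor.to_nat_non_decreasing i (num_code c)). unfold j. lia. }
  assert (Htask : task j = cenum lpath (ccons (cleft (lift (j - i) c)) coracle)).
  { unfold task, j at 1. now rewrite Cantor.cancel_of_to, nth_num_code. }
  assert (Hc' := represents_lift_le e Zs c 0 i j T Ht Hij Hc).
  destruct (proj2 Ht j) as (P & HZ & HP).
  assert (Hpath : forall n, T (seqcode (pre P n))).
  { intros n. apply NNPP; intros Hn. unfold avoids in HP. rewrite Htask in HP.
    apply HP; [exists P0|]; rewrite (enum_path_iff _ _ T); eauto.
    intros [m Hm]. now apply Hm. }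
  assert (Hg : forall n k, interp obranch (Zs (S j)) (Zs (S j)) (pr n k) <-> k = bit (P n)).
  { intros n k. unfold interp. split.
    - intros (n' & b & H & Hb). pr_inj. f_equal. rewrite HZ, join_odd in Hb.
      destruct b, (P n'); intuition congruence.
    - intros ->. exists n, (P n). rewrite HZ, join_odd. easy. }
  exists (interp obranch (Zs (S j)) (Zs (S j))). split.
  { apply (model_op e); auto using continuous_branch, model_oracle. }
  split; [split; [|split]|].
  - intros p (n & b & -> & _). eauto.
  - intros n _. exists (bit (P n)). now apply Hg.
  - intros n k k' [H1 H2]. apply Hg in H1, H2. congruence.
  - intros n. exists (seqcode (pre P n)).
    pose proof (seqcode_binseq (pre P n)) as [Hs _]. rewrite length_pre in Hs.
    split; [easy|]. split; [|easy].
    intros p Hp. apply mem_fcode, in_seqgraph in Hp as (k & Hk & ->).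
    rewrite length_pre in Hk. apply Hg. now rewrite nth_pre.
Qed.

(** Induction holds because the numbers are standard; the set existence axioms are closure
    properties of the tower. *)
Lemma model_sat_WKL0 e Zs : tower e Zs -> forall p, WKL0 p ->
  forall N E, (forall i, model Zs (E i)) -> sat (model Zs) N E p.
Proof.
  intros Ht p Hp N E HE. destruct Hp as [p Hp|].
  - destruct Hp as [| | | | | | | |p Hp|p q Hp Hq]; simpl.
    1-8: intros; lia.
    + intros [H0 HS] x. induction x as [|x IH].
      * now apply (sat_instN (model Zs) N E tzero).
      * specialize (HS x IH). revert HS. apply sat_subst; [|easy].
        intros [|n]; simpl; [lia|easy].
    + intros Heq. exists (fun x => sat (model Zs) (scons x N) E p). split.
      * now apply (model_comprehension e Zs p q).
      * intros x. rewrite sat_liftS. easy.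
  - apply sat_weak_konig. intros T HT [H1 H2]. now apply (model_weak_konig e).
Qed.

(** * Two compact spaces with a noncompact product *)

(** These sets are written as values of [interp], so that [model_op] places them in the model. *)
Definition nat_set (Z : set) : set := interp onat Z Z.
Definition pair_set (Z : set) : set := interp opairs Z Z.
Definition meet_set (Z : set) : set := interp omeet Z Z.

(* The index [pr x n] names {x} together with all w such that [S b w x n]; this
   set is cofinite if [n < e b x] and finite otherwise. *)
Definition nbhds (b : bool) (Z : set) : set := interp (onbhd b) Z Z.

Lemma continuous_const o : (forall Y0 Y1 Y0' Y1' v, interp o Y0 Y1 v -> interp o Y0' Y1' v) ->
  continuous o.
Proof. intros H. apply (continuous_of_bound _ (fun _ => 0)). intros v E E' _. split; apply H. Qed.

Lemma nbhds_pr b S z x n : nbhds b (oracle S) (pr z (pr x n)) <-> z = x \/ S b z x n.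
Proof.
  rewrite <- oracle_pr. split.
  - intros (z' & x' & n' & H & Hz). pr_inj. exact Hz.
  - intros H. exists z, x, n. auto.
Qed.

(** The index (z,n+n') works at z: for a neighbourhood centred at z by monotonicity in n, for any
    other by transitivity. *)
Lemma nbhds_space b S : coherent S ->
  is_space (nat_set (oracle S)) (pair_set (oracle S)) (nbhds b (oracle S))
    (meet_set (oracle S)).
Proof.
  intros (C1 & C2 & C3). split; [|split; [|split]].
  - intros p (z & x & n & -> & _). exists z, (pr x n).
    split; [easy|]. split; [|easy]. now exists x, n.
  - split; [|split].
    + intros p (z & x & n & x' & n' & ->).
      exists (pr (pr z (pr x n)) (pr x' n')), (pr z (n + n')).
      split; [|split; [|easy]].
      * exists z, (pr x n), (pr x' n').
        split; [easy|]. split; [now exists x, n|]. split; [now exists x', n'|easy].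
      * now exists z, (n + n').
    + intros p (z & i & j & _ & (x & n & ->) & (x' & n' & ->) & ->).
      exists (pr z (n + n')). now exists z, x, n, x', n'.
    + intros p q q' [(z & x & n & x' & n' & H) (z1 & x1 & n1 & x1' & n1' & H1)].
      pr_inj. easy.
  - intros z _. exists (pr z 0). split; [now exists z, 0|]. apply nbhds_pr. now left.
  - intros z i j n (Hi & Hj & (z' & x & m & x' & m' & H)). pr_inj.
    assert (Hsub : forall x m k, nbhds b (oracle S) (pr z' (pr x m)) -> m <= k ->
      forall w, nbhds b (oracle S) (pr w (pr z' k)) -> nbhds b (oracle S) (pr w (pr x m))).
    { clear x m x' m' Hi Hj. intros x m k H Hm w Hw. rewrite nbhds_pr in *.
      destruct H as [->|H].
      - destruct Hw as [->|Hw]; [now left|right]. now apply C2 with k.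
      - right. destruct Hw as [->|Hw]; [easy|]. now apply C3 with z' k. }
    split; [apply nbhds_pr; now left|].
    intros w Hw. split; (eapply Hsub; [eassumption| |exact Hw]); lia.
Qed.

(** Only the positive side is open, as the search through the enumeration is unbounded; [dominates]
    consults that side alone. *)
Lemma open_caught v E : open_at (fun E => interp ocaught (E 0) (E 1) v) E.
Proof.
  intros (z & n & x & m & a & -> & H0 & Hm & H1).
  exists (2 + pr m a + pr z (pr x n)). intros E' H. exists z, n, x, m, a.
  split; [easy|]. split; [|split; [easy|]].
  - apply (agreeS_at _ _ _ 0 _ H); lia || easy.
  - apply (agreeS_at _ _ _ 1 _ H); lia || easy.
Qed.

Lemma collect_below (R : nat -> nat -> Prop) s : (forall z, exists i, R z i) ->
  exists l, (forall z, z < s -> exists i, In i l /\ R z i)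
            /\ (forall i, In i l -> exists z, R z i).
Proof.
  intros H. induction s as [|s (l & H1 & H2)].
  - exists []. split; [lia|easy].
  - destruct (H s) as [i Hi]. exists (i :: l). split.
    + intros z Hz. destruct (Nat.eq_dec z s) as [->|Hne].
      * exists i. split; [now left|easy].
      * destruct (H1 z) as (i' & Hin & HR); [lia|]. exists i'. split; [now right|easy].
    + intros i' [<-|Hin]; eauto.
Qed.

(* A cover without a finite subcover contains no cofinite neighbourhood, and then
   the indices of neighbourhoods of [z] in it bound [e b z]. *)
Lemma nbhds_compact b S e Zs :
  coherent S -> limits S e -> tower e Zs -> Zs 0 = oracle S ->
  is_compact (model Zs) (nat_set (oracle S)) (pair_set (oracle S)) (nbhds b (oracle S)).
Proof.
  intros (C1 & C2 & C3) Hlim Ht H0 A HA (_ & HI & Hcov).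
  set (U := nbhds b (oracle S)) in *.
  assert (Hc : forall z, exists i, mem_enum i A /\ U (pr z i)) by (intros z; now apply Hcov).
  destruct (classic (exists x n, mem_enum (pr x n) A /\ n < e b x)) as [(x & n & Hx & Hn)|Hthin].
  - destruct (Hlim b x) as [s Hs].
    destruct (collect_below (fun z i => mem_enum i A /\ U (pr z i)) s Hc) as (l & H1 & H2).
    exists (fcode (pr x n :: l)). split; [apply fcode_finset|]. split.
    + intros i [<-|Hi]%mem_fcode; [easy|]. now destruct (H2 i Hi) as (z & ? & _).
    + intros z. split; [|easy]. intros _.
      destruct (lt_dec z s) as [Hz|Hz].
      * destruct (H1 z Hz) as (i & Hi & _ & HU). exists i. split; [|easy].
        apply mem_fcode. now right.
      * exists (pr x n). split; [apply mem_fcode; now left|].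
        apply nbhds_pr. right. apply Hs; [lia|easy].
  - exfalso.
    assert (HU : model Zs U).
    { unfold U. rewrite <- H0.
      apply (model_op e); auto using continuous_nbhd, model_oracle. }
    destruct (model_env e Zs Ht 2 (scons A (scons U (fun _ => A)))) as (j & c & E & HE & Hrep).
    { intros [|[|i]] Hi; simpl; easy || lia. }
    assert (Hd : forall v, den (cenum (lop ocaught) c) 0 true (Zs j) v <-> interp ocaught A U v).
    { intros v. rewrite <- (HE 0 ltac:(lia) : _ = A), <- (HE 1 ltac:(lia) : _ = U).
      apply (enum_open c (Zs j) E (fun E => interp ocaught (E 0) (E 1) v) Hrep).
      apply open_caught. }
    apply (proj1 Ht j b (cenum (lop ocaught) c)). split.
    + intros z. destruct (Hc z) as (i & (m & a & Hm & Ha) & Hi).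
      destruct (HI i) as (x & n & ->); [now exists m, a|].
      exists n. apply Hd. now exists z, n, x, m, a.
    + intros z n' Hz. apply Hd in Hz as (z' & n & x & m & a & H & Hm & Ha & HUz). pr_inj.
      assert (Hn : e b x <= n).
      { apply Nat.nlt_ge. intros Hlt. apply Hthin. exists x, n. split; [|easy]. now exists m, a. }
      apply nbhds_pr in HUz as [->|HUz]; [easy|].
      (* If the value at z' were positive, S_b(z',0) would be cofinite; by transitivity so would
         S_b(x,n), against [Hn]. *)
      destruct (Nat.eq_dec (e b z') 0) as [Hz|Hz]; [lia|].
      destruct (Hlim b z') as [s1 Hs1], (Hlim b x) as [s2 Hs2].
      assert (HS : S b (s1 + s2) x n).
      { apply C3 with z' 0; [easy|]. apply Hs1; lia. }
      apply Hs2 in HS; lia.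
Qed.

(** * The cover of the product by boxes *)

Definition box (x y : nat) : nat := pr (pr x (x + y)) (pr y (x + y)).

Lemma in_boxlist n p : In p (boxlist n) <-> exists x y, x < n /\ y < n /\ p = box x y.
Proof.
  unfold boxlist. rewrite in_map_iff. split.
  - intros ([x y] & <- & H). apply in_prod_iff in H as [Hx Hy].
    apply in_seq in Hx, Hy. exists x, y. split; [lia|]. split; [lia|easy].
  - intros (x & y & Hx & Hy & ->). exists (x, y). split; [easy|].
    apply in_prod; apply in_seq; lia.
Qed.

Lemma mem_boxes Z i : mem_enum i (interp odiag Z Z) <-> exists x y, i = box x y.
Proof.
  split.
  - intros (n & a & (n' & H) & Hi). pr_inj. apply mem_fcode, in_boxlist in Hi.
    destruct Hi as (x & y & _ & _ & ->). eauto.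
  - intros (x & y & ->). exists (S (x + y)), (fcode (boxlist (S (x + y)))).
    split; [now exists (S (x + y))|]. apply mem_fcode, in_boxlist.
    exists x, y. split; [lia|]. split; [lia|easy].
Qed.

Lemma boxes_enumeration Z : is_enumeration (interp odiag Z Z).
Proof.
  split; [split; [|split]|].
  - intros p (n & ->). exists n, (fcode (boxlist n)).
    split; [easy|]. split; [apply fcode_finset|easy].
  - intros n _. exists (fcode (boxlist n)). now exists n.
  - intros n a a' [(m & H) (m' & H')]. pr_inj. easy.
  - intros m n a a' (Hmn & (m' & H) & (n' & H')). pr_inj.
    intros i Hi. rewrite mem_fcode, in_boxlist in *.
    destruct Hi as (x & y & Hx & Hy & ->). exists x, y. split; [lia|]. split; [lia|easy].
Qed.

Definition box_set (Z : set) : set := interp oboxes (nbhds true Z) (nbhds false Z).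

Lemma box_set_pr S z x y :
  box_set (oracle S) (pr (pr z z) (box x y)) <->
  (z = x \/ S true z x (x + y)) /\ (z = y \/ S false z y (x + y)).
Proof.
  rewrite <- !nbhds_pr. split.
  - intros (x' & y' & i & j & H1 & H2 & H). unfold box in H. pr_inj. easy.
  - intros [H1 H2]. now exists z, z, (pr x (x + y)), (pr y (x + y)).
Qed.

(** By separation one side of each box is finite, so the box misses the diagonal from some point on;
    finitely many boxes have a common such point. *)
Lemma boxes_miss_diagonal S e : separated e -> limits S e ->
  forall N, exists L, forall x y z, box x y < N -> L <= z ->
    ~ box_set (oracle S) (pr (pr z z) (box x y)).
Proof.
  intros Hsep Hlim N.
  assert (H1 : forall x y, exists L, forall z, L <= z ->
            ~ box_set (oracle S) (pr (pr z z) (box x y))).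
  { intros x y. destruct (Hsep x y) as [H|H].
    - destruct (Hlim true x) as [s Hs]. exists (s + x + 1). intros z Hz.
      rewrite box_set_pr, Hs by lia. lia.
    - destruct (Hlim false y) as [s Hs]. exists (s + y + 1). intros z Hz.
      rewrite box_set_pr, (Hs z) by lia. lia. }
  induction N as [|N [L HL]]; [exists 0; lia|].
  destruct (classic (exists x y, box x y = N)) as [(x & y & Hxy)|Hno].
  - destruct (H1 x y) as [L' HL']. exists (L + L'). intros x' y' z Hlt Hz.
    destruct (Nat.eq_dec (box x' y') N) as [->|Hne].
    + rewrite <- Hxy. apply HL'. lia.
    + apply HL; lia.
  - exists L. intros x y z Hlt Hz. apply HL; [|easy].
    assert (box x y <> N) by (intros Heq; apply Hno; eauto). lia.
Qed.

Lemma product_not_compact S e Zs :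
  separated e -> limits S e -> tower e Zs -> Zs 0 = oracle S ->
  ~ is_compact (model Zs) (pair_set (oracle S)) (interp opairs2 (oracle S) (oracle S))
      (box_set (oracle S)).
Proof.
  intros Hsep Hlim Ht H0 Hcomp.
  destruct (Hcomp (interp odiag (oracle S) (oracle S))) as (a & _ & Ha & Hcov).
  - rewrite <- H0. apply (model_op e); auto using model_oracle.
    apply continuous_const; auto.
  - split; [apply boxes_enumeration|]. split.
    + intros i (x & y & ->)%mem_boxes. exists (pr x (x + y)), (pr y (x + y)).
      split; [now exists x, (x + y)|]. split; [now exists y, (x + y)|easy].
    + intros p. split.
      * intros (x & y & ->). exists (box x y). split; [apply mem_boxes; eauto|].
        exists x, y, (pr x (x + y)), (pr y (x + y)).
        split; [apply nbhds_pr; now left|]. split; [apply nbhds_pr; now left|easy].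
      * intros (i & _ & (x & y & i' & j' & _ & _ & H)). pr_inj. now exists x, y.
  (* The elements of a finite set are smaller than its code [a], which thus serves as the bound. *)
  - destruct (boxes_miss_diagonal S e Hsep Hlim a) as [L HL].
    destruct (proj1 (Hcov (pr L L))) as (i & Hi & HW); [now exists L, L|].
    specialize (Ha i Hi). apply mem_boxes in Ha as (x & y & ->).
    apply mem_fin_lt in Hi. now apply (HL x y L).
Qed.

Theorem mainTheorem4 : ~ proves WKL0 (sentence ProductOfCompactIsCompact).
Proof.
  intros Hprv.
  destruct generic_structure as (S & e & HC & Hsep & Hlim & Hund).
  destruct (tower_exists e _ Hund) as (Zs & Ht & H0).
  assert (Hsat : sat (model Zs) (fun _ => 0) (fun _ => Zs 0)
                   (sentence ProductOfCompactIsCompact)).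
  { apply (soundness (model Zs) WKL0 (model_sat_WKL0 e Zs Ht) [] _ Hprv).
    - intros _. apply model_oracle.
    - easy. }
  rewrite sat_product in Hsat.
  assert (Hop : forall o, continuous o -> model Zs (interp o (oracle S) (oracle S))).
  { intros o Ho. rewrite <- H0. apply (model_op e); auto using model_oracle. }
  assert (Hconst : forall o, (forall Y0 Y1 Y0' Y1' v, interp o Y0 Y1 v -> interp o Y0' Y1' v) ->
            model Zs (interp o (oracle S) (oracle S))).
  { intros o Ho. now apply Hop, continuous_const. }
  assert (Hnat : model Zs (nat_set (oracle S))) by (apply Hconst; auto).
  assert (Hpair : model Zs (pair_set (oracle S))) by (apply Hconst; auto).
  assert (Hmeet : model Zs (meet_set (oracle S))) by (apply Hconst; auto).
  assert (Hnb : forall b, model Zs (nbhds b (oracle S)))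
    by (intros b; apply Hop, continuous_nbhd).
  apply (product_not_compact S e Zs Hsep Hlim Ht H0).
  (* Compactness does not mention the function of the product, so it has to be supplied; the other
     sets are found by unification. *)
  apply (Hsat _ Hnat _ Hpair _ (Hnb true) _ Hmeet _ Hnat _ Hpair _ (Hnb false) _ Hmeet)
    with (m := interp omeet2 (oracle S) (oracle S)).
  - assert (Hb : forall b, is_space (nat_set (oracle S)) (pair_set (oracle S))
                               (nbhds b (oracle S)) (meet_set (oracle S))
                           /\ is_compact (model Zs) (nat_set (oracle S))
                                (pair_set (oracle S)) (nbhds b (oracle S))).
    { intros b. split; [now apply nbhds_space|now apply (nbhds_compact b S e)]. }
    destruct (Hb true), (Hb false). auto.
  - exact Hpair.
  - apply Hconst; auto.
  - apply (model_op e); auto using continuous_boxes.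
  - apply Hconst; auto.
  - split; [|split; [|split]].
    + intros p. split.
      * intros (x & y & ->). now exists x, y.
      * intros (x & y & _ & _ & ->). now exists x, y.
    (* The remaining clauses are the definitions of [opairs2], [oboxes] and [omeet2]. *)
    + intros p. easy.
    + intros p. easy.
    + intros p. easy.
Qed.
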